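(* Let $p \in (1,\infty)$, $s \in (0,1)$, $N > sp$, $p_s^\ast = Np/(N-sp)$ and $q \in (p,p_s^\ast)$. Let $V, K, L$ be positive continuous functions on $\mathbb{R}^N$ such that $K$ and $L$ are bounded and $$\lim_{|x|\to\infty} \frac{K(x)}{V(x)} = 0, \qquad \lim_{|x|\to\infty} \frac{L(x)}{V(x)^{[Np-(N-sp)q]/(sp^2)}} = 0.$$ Then $X$ is compactly embedded in $L^p_K(\mathbb{R}^N) \cap L^q_L(\mathbb{R}^N)$.
   Context: Functions are real-valued and measurable on $\mathbb{R}^N$, identified when equal a.e. For $u:\mathbb{R}^N\to\mathbb{R}$ set $[u]_{s,p} = \left(\int_{\mathbb{R}^{2N}} \frac{|u(x)-u(y)|^p}{|x-y|^{N+sp}}\,dx\,dy\right)^{1/p}$ and $|u|_{p,V} = \left(\int_{\mathbb{R}^N} V(x)|u|^p\,dx\right)^{1/p}$. The space $$X = \{u \in L^{p_s^\ast}(\mathbb{R}^N) : [u]_{s,p} < \infty,\ |u|_{p,V} < \infty\}$$ is a reflexive Banach space with the norm given by $\|u\|^p = [u]_{s,p}^p + |u|_{p,V}^p$. The weighted Lebesgue spaces are $L^p_K(\mathbb{R}^N) = \{u : \int_{\mathbb{R}^N} K(x)|u|^p\,dx < \infty\}$ and $L^q_L(\mathbb{R}^N) = \{u : \int_{\mathbb{R}^N} L(x)|u|^q\,dx < \infty\}$, normed by $|u|_{p,K} = \left(\int_{\mathbb{R}^N} K(x)|u|^p\,dx\right)^{1/p}$ and $|u|_{q,L} = \left(\int_{\mathbb{R}^N}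 L(x)|u|^q\,dx\right)^{1/q}$, respectively. The intersection carries the norm $|u|_{p,K}+|u|_{q,L}$ (convergence in both norms). *)

(* Defs.v *)
From HB Require Import structures.
From mathcomp Require Import all_boot all_order all_algebra.
From mathcomp Require Import all_classical all_reals all_analysis.

Set Implicit Arguments.
Unset Strict Implicit.
Unset Printing Implicit Defensive.

Import Order.TTheory GRing.Theory Num.Theory.
Import numFieldNormedType.Exports.

Local Open Scope classical_set_scope.
Local Open Scope ring_scope.

(* R^n is 'rV[R]_n. Its measurable sets are the product (= Borel)
   sigma-algebra; since functions are identified a.e., Borel and Lebesgue
   measurability of functions give the same classes. *)
Definition rV_display : measure_display.
Proof. exact: default_measure_display. Qed.

Section measurable_rV.
Context {R : realType} {n : nat}.

Definition rV_coord (i : 'I_n) (x : 'rV[R]_n) : measurableTypeR R := x 0 i.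

Let rV_set0 : g_sigma_preimage rV_coord set0.
Proof. exact: sigma_algebra0. Qed.

Let rV_setC A : g_sigma_preimage rV_coord A ->
  g_sigma_preimage rV_coord (~` A).
Proof. exact: sigma_algebraC. Qed.

Let rV_bigcup (F : (set 'rV[R]_n)^nat) :
  (forall i, g_sigma_preimage rV_coord (F i)) ->
  g_sigma_preimage rV_coord (\bigcup_i (F i)).
Proof. exact: sigma_algebra_bigcup. Qed.

HB.instance Definition _ := @isMeasurable.Build rV_display
  'rV[R]_n (g_sigma_preimage rV_coord) rV_set0 rV_setC rV_bigcup.

End measurable_rV.

Lemma measurable_rVP (R : realType) n d (T : measurableType d)
    (f : T -> 'rV[R]_n) :
  measurable_fun [set: T] f <->
  forall i, measurable_fun [set: T] (@rV_coord R n i \o f).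
Proof.
apply: (@iff_trans _ (g_sigma_preimage
    (fun i => @rV_coord R n i \o f) `<=` measurable)).
  rewrite g_sigma_preimage_comp; split=> [mf A [/= C preC <-]|prefS].
    exact: mf.
  by move=> _ A mA; apply: prefS; exists A.
split=> [fS i|mf].
- move=> _ A mA.
  apply: fS; apply: sub_sigma_algebra.
  case: n i => [[] []//|n i] in f *.
  rewrite -bigcup_mkord_ord.
  exists i; first exact: ltn_ord.
  by exists A => //; rewrite inord_val.
- apply: smallest_sub; first exact: sigma_algebra_measurable.
  case: n => [|n] in f mf *; first by rewrite big_ord0.
  rewrite -bigcup_mkord_ord; apply: bigcup_sub => i Ii.
  by move=> A [B mB <-]; exact: mf.
Qed.

Lemma measurable_rV_coord (R : realType) n (i : 'I_n) :
  measurable_fun [set: 'rV[R]_n] (rV_coord i).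
Proof. by have /measurable_rVP := @measurable_id _ 'rV[R]_n setT; apply. Qed.

Section lebesgue_rV_succ.
Context {R : realType} {n : nat}.

Definition cons_rV (z : measurableTypeR R * 'rV[R]_n) : 'rV[R]_n.+1 :=
  row_mx (z.1 : R)%:M z.2.

Lemma cons_rV0 z : cons_rV z 0 0 = z.1.
Proof. by rewrite mxE; case: splitP => // j _; rewrite ord1 mxE eqxx. Qed.

Lemma cons_rVS z (i : 'I_n) : cons_rV z 0 (lift 0 i) = z.2 0 i.
Proof.
rewrite mxE; case: splitP => j; first by rewrite ord1.
by rewrite lift0 add1n => -[] /val_inj ->.
Qed.

Lemma measurable_cons_rV : measurable_fun setT cons_rV.
Proof.
apply/measurable_rVP => i; case: (unliftP 0 i) => [j|] ->.
  rewrite (_ : _ \o _ = rV_coord j \o snd).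
    by apply: measurableT_comp => //; exact: measurable_rV_coord.
  by apply/funext => z; rewrite /= /rV_coord cons_rVS.
rewrite (_ : _ \o _ = fst); first exact: measurable_fst.
by apply/funext => z; rewrite /= /rV_coord cons_rV0.
Qed.

Section measure.
Variable mu : {sigma_finite_measure set 'rV[R]_n -> \bar R}.

Definition lebesgue_rV_succ : set 'rV[R]_n.+1 -> \bar R :=
  pushforward (lebesgue_measure \x mu)%E cons_rV.

Let lebesgue_rV_succ0 : lebesgue_rV_succ set0 = 0%E.
Proof. by rewrite /lebesgue_rV_succ /pushforward preimage_set0 measure0. Qed.

Let lebesgue_rV_succ_ge0 A : (0 <= lebesgue_rV_succ A)%E.
Proof. by rewrite /lebesgue_rV_succ /pushforward measure_ge0. Qed.

Let lebesgue_rV_succ_additive : semi_sigma_additive lebesgue_rV_succ.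
Proof.
have mc A : measurable A -> measurable (cons_rV @^-1` A).
  by move=> mA; rewrite -[X in measurable X]setTI; exact: measurable_cons_rV.
move=> F mF tF mUF; rewrite /lebesgue_rV_succ /pushforward preimage_bigcup.
apply: measure_semi_sigma_additive.
- by move=> k; exact: mc.
- apply/trivIsetP => /= i j _ _ ij; rewrite -preimage_setI.
  by move/trivIsetP : tF => /(_ _ _ _ _ ij) ->//; rewrite preimage_set0.
- by rewrite -preimage_bigcup; exact: mc.
Qed.

HB.instance Definition _ := isMeasure.Build _ _ _ lebesgue_rV_succ
  lebesgue_rV_succ0 lebesgue_rV_succ_ge0 lebesgue_rV_succ_additive.

Definition uncons_rV (x : 'rV[R]_n.+1) : measurableTypeR R * 'rV[R]_n :=
  (x 0 0, \row_i x 0 (lift 0 i)).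

Lemma cons_rVK : cancel cons_rV uncons_rV.
Proof.
move=> z; rewrite /uncons_rV cons_rV0 [RHS]surjective_pairing; congr pair.
by apply/rowP => i; rewrite mxE cons_rVS.
Qed.

Lemma measurable_uncons_rV : measurable_fun setT uncons_rV.
Proof.
apply/measurable_fun_pairP; split; first exact: (measurable_rV_coord 0).
apply/measurable_rVP => i.
rewrite (_ : _ \o _ = rV_coord (lift 0 i)); first exact: measurable_rV_coord.
by apply/funext => x; rewrite /= /rV_coord mxE.
Qed.

Let lebesgue_rV_succ_sigma_finite : sigma_finite setT lebesgue_rV_succ.
Proof.
have /sigma_finiteP[F [TF ndF mF]] := sigma_finiteT (@lebesgue_measure R).
have /sigma_finiteP[G [TG ndG mG]] := sigma_finiteT mu.
exists (fun k => uncons_rV @^-1` (F k `*` G k)).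
  rewrite -preimage_bigcup (_ : \bigcup_k _ = setT) ?preimage_setT//.
  apply/seteqP; split => // -[x y] _.
  have [i _ Fx] : (\bigcup_k F k) x by rewrite -TF.
  have [j _ Gy] : (\bigcup_k G k) y by rewrite -TG.
  exists (maxn i j) => //; split.
    by move: x Fx; exact/subsetPset/ndF/leq_maxl.
  by move: y Gy; exact/subsetPset/ndG/leq_maxr.
move=> k; have [mFk Fk] := mF k; have [mGk Gk] := mG k; split.
  rewrite -[X in measurable X]setTI; apply: measurable_uncons_rV => //.
  exact: measurableX.
rewrite /lebesgue_rV_succ /pushforward -comp_preimage.
rewrite (_ : _ \o _ = id); last by apply/funext => z; exact: cons_rVK.
by rewrite preimage_id product_measure1E// lte_mul_pinfty// ge0_fin_numE.
Qed.

HB.instance Definition _ := Measure_isSigmaFinite.Build _ _ _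
  lebesgue_rV_succ lebesgue_rV_succ_sigma_finite.

End measure.
End lebesgue_rV_succ.

Fixpoint lebesgue_rV {R : realType} (n : nat) :
    {sigma_finite_measure set 'rV[R]_n -> \bar R} :=
  if n is m.+1 then lebesgue_rV_succ (lebesgue_rV m) else \d_(0 : 'rV[R]_0).

Lemma lebesgue_rV_box (R : realType) n (a b : 'rV[R]_n) :
  (forall i, a 0 i <= b 0 i) ->
  lebesgue_rV n [set x : 'rV[R]_n | forall i, a 0 i <= x 0 i <= b 0 i] =
  (\prod_(i < n) (b 0 i - a 0 i))%:E.
Proof.
elim: n a b => [|n IH] a b ab.
  by rewrite big_ord0 /= diracE mem_set//= => -[].
rewrite big_ord_recl.
rewrite -[LHS]/((lebesgue_measure \x lebesgue_rV n)%E (cons_rV @^-1`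
  [set x : 'rV[R]_n.+1 | forall i, a 0 i <= x 0 i <= b 0 i])).
pose tl (x : 'rV[R]_n.+1) : 'rV[R]_n := \row_i x 0 (lift 0 i).
have -> : cons_rV @^-1` [set x : 'rV[R]_n.+1 | forall i, a 0 i <= x 0 i <= b 0 i] =
    [set` `[a 0 0, b 0 0]] `*`
    [set x : 'rV[R]_n | forall i, tl a 0 i <= x 0 i <= tl b 0 i].
  apply/seteqP; split => z /=.
    move=> h; split; first by have := h 0; rewrite cons_rV0 in_itv.
    by move=> i; have := h (lift 0 i); rewrite cons_rVS !mxE.
  rewrite in_itv /= => -[h0 h] i; case: (unliftP 0 i) => [j|] ->.
    by have := h j; rewrite cons_rVS !mxE.
  by rewrite cons_rV0.
rewrite product_measure1E//; last first.
  rewrite (_ : [set x | _] = \bigcap_(i in [set: 'I_n])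
      (rV_coord i @^-1` [set` `[tl a 0 i, tl b 0 i]])).
    apply: fin_bigcap_measurable; first exact: finite_finset.
    move=> i _; rewrite -[X in measurable X]setTI.
    by apply: measurable_rV_coord.
  apply/seteqP; split => x /=; first by move=> h i _ /=; rewrite in_itv; exact: h.
  by move=> h i; have := h i I; rewrite /= in_itv.
have abt i : tl a 0 i <= tl b 0 i by rewrite !mxE.
rewrite IH//; under eq_bigr do rewrite !mxE.
rewrite EFinM; congr (_ * _)%E.
transitivity (@lebesgue_measure R [set` `[a 0 0, b 0 0]]); first by [].
rewrite lebesgue_measure_itv /= lte_fin; case: ltP => // ba.
by rewrite (_ : b 0 0 = a 0 0) ?subrr//; apply/le_anti; rewrite ba ab.
Qed.

Definition eucl_norm {R : realType} {n : nat} (x : 'rV[R]_n) : R :=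
  Num.sqrt (\sum_(i < n) x 0 i ^+ 2).

(* the filter |x| --> oo *)
Definition eucl_infty (R : realType) (n : nat) : set_system 'rV[R]_n :=
  filter_from [set: R] (fun M => [set x | M < eucl_norm x]).
Arguments eucl_infty : clear implicits.

#[global] Instance eucl_infty_filter (R : realType) (n : nat) :
  Filter (eucl_infty R n).
Proof.
apply: filter_from_filter; first by exists 0.
move=> M M' _ _; exists (Num.max M M') => // x /=.
by rewrite gt_max => /andP[].
Qed.

Definition sobolev_exponent {R : realType} (N : nat) (s p : R) : R :=
  N%:R * p / (N%:R - s * p).

Section function_spaces.
Context {R : realType} {N : nat}.
Implicit Types (u V : 'rV[R]_N -> R) (p s : R).
Local Open Scope ereal_scope.
Local Notation leb := (@lebesgue_rV R N).

(* on the diagonal, a null set, the integrand is 0 by the convention 0^-1 = 0 *)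
Definition gagliardo s p u : \bar R :=
  (\int[leb \x leb]_z
     (`|u z.1 - u z.2| `^ p
        / eucl_norm (z.1 - z.2) `^ (N%:R + s * p))%R%:E) `^ p^-1.

Definition wnorm V p u : \bar R :=
  (\int[leb]_x (V x * `|u x| `^ p)%R%:E) `^ p^-1.

Definition Xspace V s p : set ('rV[R]_N -> R) :=
  [set u | [/\ u \in Lfun leb (sobolev_exponent N s p)%:E,
               gagliardo s p u < +oo & wnorm V p u < +oo]].

Definition Xnorm V s p u : \bar R :=
  (gagliardo s p u `^ p + wnorm V p u `^ p) `^ p^-1.

Definition wLspace V p : set ('rV[R]_N -> R) :=
  [set u : 'rV[R]_N -> R | measurable_fun setT u /\
     \int[leb]_x (V x * `|u x| `^ p)%R%:E < +oo].

End function_spaces.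

(* (A, nA) and (B, nB) are spaces of functions, seen as representatives of
   their classes modulo a.e. equality; "compactly" means that bounded
   sequences of A have subsequences converging in B. *)
Definition compactly_embedded {R : realType} {T : Type}
    (A : set (T -> R)) (nA : (T -> R) -> \bar R)
    (B : set (T -> R)) (nB : (T -> R) -> \bar R) : Prop :=
  [/\ A `<=` B,
      exists C : R, forall u, A u -> (nB u <= C%:E * nA u)%E
    & forall u : nat -> T -> R, (forall k, A (u k)) ->
      (exists M : R, forall k, (nA (u k) <= M%:E)%E) ->
      exists2 phi : nat -> nat, increasing_seq phi &
      exists2 v, B v &
        (fun k => nB (fun x => u (phi k) x - v x)) @ \oo --> 0%E].

(* Main.v *)
(** Sobolev: if S = int |u|^P is finite, with P the Sobolev exponent, then around
    each x, at least half of the cube of measure 2 S / (|u x| / 2)^P consists of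
    points y with |u y| < |u x| / 2; integrating the Gagliardo integrand
    over those y bounds |u x|^P by C S^(s p / N) times its integral in y, and
    integrating in x lets one divide by S^(s p / N), so S^(p / P) <= C [u]^p.

    Weights: since q is the interpolation of p and P with coefficient
    a = (P - q) / (P - p), V^a w^q <= V w^p + w^P; outside a large box this makes
    K w^p + L w^q at most e (V w^p + w^P), and inside the box it is at most
    e w^P + C w^p. So everything reduces to convergence in L^p on boxes.

    Local compactness: on a small cell a function is close in L^p to its value at
    a well-chosen point, with error controlled by the Gagliardo energy of the
    cell. Along an ultrafilter these values converge on every cell of a grid, so
    the sequence is Cauchy in L^p of every box along the ultrafilter. A fast
    Cauchy subsequence converges almost everywhere, and Fatou's lemma transfers
    all the bounds to its limit. *)

Require Import Defs.
From mathcomp Require Import all_boot all_order all_algebra.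
From mathcomp Require Import all_classical all_reals all_analysis.
From mathcomp Require Import measurable_realfun.
From mathcomp Require Import ring lra.

Import Order.TTheory GRing.Theory Num.Theory.
Import numFieldNormedType.Exports.

Local Open Scope classical_set_scope.
Local Open Scope ring_scope.

(** * Measurability, norms and cubes in Euclidean space *)

Section euclidean_space.
Context {R : realType} {N : nat}.
Implicit Types (x y : 'rV[R]_N).

Lemma measurable_rV_forall (A : 'I_N -> set R) :
  (forall i, measurable (A i)) ->
  measurable [set x : 'rV[R]_N | forall i, A i (x 0 i)].
Proof.
move=> mA.
rewrite (_ : [set x | _] = \bigcap_(i in [set: 'I_N]) (rV_coord i @^-1` A i)).
  apply: fin_bigcap_measurable; first exact: finite_finset.
  move=> i _; rewrite -[X in measurable X]setTI.
  by apply: measurable_rV_coord => //; exact: mA.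
by apply/seteqP; split => x /= h i => [_|]; exact: h.
Qed.

(** Each point of [U] lies in a cube with rational centre and half-side [1/(n+1)] contained in [U],
    so [U] is a countable union of such cubes. This ties the topology to the sigma-algebra generated
    by the coordinates. *)
Lemma open_measurable_rV (U : set 'rV[R]_N) : open U -> measurable U.
Proof.
move=> oU.
pose B (k : 'rV[rat]_N * nat) : set 'rV[R]_N :=
  [set x | forall i, `[ratr (k.1 0 i) - k.2.+1%:R^-1,
                       ratr (k.1 0 i) + k.2.+1%:R^-1]%classic (x 0 i)].
rewrite (_ : U = \bigcup_k (if `[< B k `<=` U >] then B k else set0)).
  apply: countable_bigcupT_measurable => [|k]; first exact: countableP.
  case: ifP => // _.
  apply: (@measurable_rV_forall (fun i => `[ratr (k.1 0 i) - k.2.+1%:R^-1,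
    ratr (k.1 0 i) + k.2.+1%:R^-1]%classic)) => i; exact: measurable_itv.
apply/seteqP; split => [x Ux|x [k _]]; last by case: ifP => // /asboolP; exact.
have /nbhs_ballP[e /= e0 xeU] := open_nbhs_nbhs (conj oU Ux).
(* Two points of a cube of half-side [1/(n+1)] differ by at most [2/(n+1) < 2e/3] in each
   coordinate. *)
have e30 : 0 < e / 3 by rewrite divr_gt0.
have [n _ /(_ n (leqnn _)) /= ne] := near_infty_natSinv_lt (PosNum e30).
have n0 : 0 < n.+1%:R^-1 :> R by rewrite invr_gt0.
have ratx i : {q : rat | `|x 0 i - ratr q| <= n.+1%:R^-1}.
  apply: cid.
  have /rat_in_itvoo[q] : x 0 i - n.+1%:R^-1 < x 0 i + n.+1%:R^-1.
    by move: n0; move: (n.+1%:R^-1) => m m0; lra.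
  by rewrite inE => /itvP qi; exists q; rewrite ler_distlC !qi.
have qx : B (\row_i sval (ratx i), n) x.
  by move=> i /=; rewrite in_itv/= mxE -ler_distl; exact: svalP (ratx i).
exists (\row_i sval (ratx i), n) => //; rewrite asboolT// => y By.
apply: xeU; split=> // i j; rewrite (ord1 i) /ball/=.
have := By j; have := qx j; rewrite /= !in_itv/=.
set m := n.+1%:R^-1 in ne *; move: (ratr _) => t; move: m ne.
move=> m me /andP[? ?] /andP[? ?].
by rewrite ltr_norml; apply/andP; split; lra.
Qed.

Lemma continuous_measurable_rV (f : 'rV[R]_N -> R) :
  continuous f -> measurable_fun [set: 'rV[R]_N] f.
Proof.
move=> /continuousP cf; apply: (measurability _ (RGenOpens.measurableE R)).
move=> _ [_ [a [b ->] <-]]; rewrite setTI.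
by apply: open_measurable_rV; exact/cf/interval_open.
Qed.

Lemma eucl_norm_ge0 x : 0 <= eucl_norm x.
Proof. exact: sqrtr_ge0. Qed.

Lemma coord_le_eucl_norm x i : `|x 0 i| <= eucl_norm x.
Proof.
rewrite -sqrtr_sqr /eucl_norm ler_wsqrtr// (bigD1 i)//= lerDl sumr_ge0// => j _.
exact: sqr_ge0.
Qed.

Lemma eucl_norm_le x (r : R) : (forall i, `|x 0 i| <= r) ->
  eucl_norm x <= Num.sqrt N%:R * `|r|.
Proof.
move=> xr; rewrite -sqrtr_sqr -sqrtrM ?ler0n// /eucl_norm ler_wsqrtr//.
rewrite -[X in X%:R * _](card_ord N) -sum1_card natr_sum mulr_suml.
apply: ler_sum => i _; rewrite mul1r -real_normK ?num_real// -[leRHS]real_normK ?num_real//.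
by rewrite ler_sqr ?nnegrE// (le_trans (xr i))// ler_norm.
Qed.

Lemma measurable_eucl_norm d (T : measurableType d) (f : T -> 'rV[R]_N) :
  measurable_fun setT f -> measurable_fun setT (eucl_norm \o f).
Proof.
move=> mf; rewrite (_ : _ \o _ =
    (@powR R ^~ 2^-1) \o (fun t => \sum_(i < N) (rV_coord i \o f) t ^+ 2)).
  apply: measurableT_comp; first exact: measurable_powR.
  apply: measurable_sum => i; apply: measurable_funX.
  by apply: measurableT_comp => //; exact: measurable_rV_coord.
apply/funext => t /=; rewrite /eucl_norm powR12_sqrt// sumr_ge0// => i _.
exact: sqr_ge0.
Qed.

Lemma measurable_rVB : measurable_fun setT
  (fun z : 'rV[R]_N * 'rV[R]_N => z.1 - z.2).
Proof.
apply/measurable_rVP => i.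
rewrite (_ : _ \o _ = (rV_coord i \o fst) \- (rV_coord i \o snd)).
  by apply: measurable_funB; apply: measurableT_comp => //;
    exact: measurable_rV_coord.
by apply/funext => z; rewrite /= /rV_coord !mxE.
Qed.

Definition cube x (r : R) : set 'rV[R]_N :=
  [set y | forall i, x 0 i - r <= y 0 i <= x 0 i + r].

Lemma measurable_cube x r : measurable (cube x r).
Proof.
rewrite (_ : cube x r =
    [set y | forall i, `[x 0 i - r, x 0 i + r]%classic (y 0 i)]).
  apply: (@measurable_rV_forall (fun i => `[x 0 i - r, x 0 i + r]%classic)) => i.
  exact: measurable_itv.
by apply/seteqP; split => y /= h i; have := h i; rewrite in_itv.
Qed.

Lemma lebesgue_cube x (r : R) : 0 <= r ->
  lebesgue_rV N (cube x r) = ((2 * r) ^+ N)%:E.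
Proof.
move=> r0; have := @lebesgue_rV_box R N (x - const_mx r) (x + const_mx r).
rewrite (_ : [set _ | _] = cube x r).
  move=> ->; last by move=> i; rewrite !mxE; lra.
  under eq_bigr => i _.
    rewrite !mxE (_ : _ - _ = 2 * r); last by ring.
    over.
  by rewrite prodr_const card_ord.
by apply/seteqP; split => y /= h i; have := h i; rewrite !mxE.
Qed.

Lemma eucl_norm_cube x y (r : R) : 0 <= r -> cube x r y ->
  eucl_norm (x - y) <= Num.sqrt N%:R * r.
Proof.
move=> r0 xy; rewrite -[X in _ * X]ger0_norm//; apply: eucl_norm_le => i.
by have := xy i; rewrite !mxE ler_norml => /andP[? ?]; lra.
Qed.

Lemma eucl_norm_eq0 x : eucl_norm x = 0 -> x = 0.
Proof.
move=> x0; apply/rowP => i; apply/eqP; rewrite !mxE -normr_le0 -x0.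
exact: coord_le_eucl_norm.
Qed.

End euclidean_space.

(** * Chebyshev-type comparison of an integral with a constant *)

Section nonneg_integral.
Context d (T : measurableType d) (R : realType).
Variable mu : {measure set T -> \bar R}.
Local Open Scope ereal_scope.

Lemma ge0_le_integral_cst (D : set T) (f : T -> \bar R) (a : R) :
  measurable D -> measurable_fun D f -> (0 <= a)%R ->
  (forall x, D x -> a%:E <= f x) ->
  a%:E * mu D <= \int[mu]_(x in D) f x.
Proof.
move=> mD mf a0 af; rewrite -integral_cst//; apply: ge0_le_integral => //.
Qed.

(** Contrapositive of [ge0_le_integral_cst]. It selects a point where a function is below a strict
    bound of its mean. *)
Lemma exists_lt_integral (D : set T) (f : T -> \bar R) (a : R) :
  measurable D -> measurable_fun D f -> (0 <= a)%R ->
  \int[mu]_(x in D) f x < a%:E * mu D ->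
  exists2 x, D x & f x < a%:E.
Proof.
move=> mD mf a0 fa; apply: contrapT => /forall2NP h.
move: fa; rewrite ltNge => /negP; apply; apply: ge0_le_integral_cst => // x Dx.
by have [//|/negP] := h x; rewrite -leNgt.
Qed.

End nonneg_integral.

(** * The fractional Sobolev inequality *)

Section gagliardo_sobolev.
Context {R : realType} {N : nat}.
Implicit Types (u : 'rV[R]_N -> R) (p s : R).
Local Notation mu := (@lebesgue_rV R N).

(** The integrand of [gagliardo], isolated for pointwise estimates; it too is 0 on the diagonal. *)
Definition gagliardo_integrand s p u (z : 'rV[R]_N * 'rV[R]_N) : R :=
  `|u z.1 - u z.2| `^ p / eucl_norm (z.1 - z.2) `^ (N%:R + s * p).

Lemma gagliardo_integrand_ge0 s p u z : 0 <= gagliardo_integrand s p u z.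
Proof. by rewrite divr_ge0// powR_ge0. Qed.

Lemma measurable_powR_norm d (T : measurableType d) (f : T -> R) p :
  measurable_fun setT f -> measurable_fun setT (fun x => `|f x| `^ p).
Proof.
move=> mf; apply: (measurableT_comp (measurable_powR p)).
exact: measurableT_comp.
Qed.

Lemma measurable_gagliardo_integrand s p u : measurable_fun setT u ->
  measurable_fun setT (gagliardo_integrand s p u).
Proof.
move=> mu_; apply: measurable_funM.
  apply: measurable_powR_norm; apply: measurable_funB.
    exact: measurableT_comp.
  exact: measurableT_comp.
rewrite (_ : (fun _ => _) =
    (@powR R ^~ (- (N%:R + s * p))) \o (eucl_norm \o (fun z => z.1 - z.2))).
  apply: measurableT_comp; first exact: measurable_powR.
  apply: measurable_eucl_norm; exact: measurable_rVB.
by apply/funext => z /=; rewrite powRN.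
Qed.

Lemma measurable_gagliardo_integrand2 s p u x : measurable_fun setT u ->
  measurable_fun setT (fun y => gagliardo_integrand s p u (x, y)).
Proof.
move=> /(measurable_gagliardo_integrand s p) mg.
exact: (measurableT_comp mg).
Qed.

(* [0 < a] excludes the diagonal, where the integrand is the junk value 0. *)
Lemma gagliardo_integrand_ge s p u x y (a d : R) :
  0 < a -> 0 <= p -> 0 <= N%:R + s * p ->
  a <= `|u x - u y| -> eucl_norm (x - y) <= d ->
  a `^ p / d `^ (N%:R + s * p) <= gagliardo_integrand s p u (x, y).
Proof.
move=> a0 p0 e0 auxy xyd; rewrite /gagliardo_integrand/=.
have [/eucl_norm_eq0/eqP|xy0] := eqVneq (eucl_norm (x - y)) 0.
  rewrite subr_eq0 => /eqP xy; move: auxy.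
  by rewrite xy subrr normr0 leNgt a0.
have xyp : 0 < eucl_norm (x - y) by rewrite lt_neqAle eq_sym xy0 eucl_norm_ge0.
apply: ler_pM; rewrite ?powR_ge0//.
- by rewrite invr_ge0 powR_ge0.
- by rewrite ge0_ler_powR// nnegrE ?normr_ge0// ltW.
rewrite lef_pV2 ?posrE ?powR_gt0//; last exact: lt_le_trans xyd.
by rewrite ge0_ler_powR// nnegrE ?eucl_norm_ge0// (le_trans (eucl_norm_ge0 _) xyd).
Qed.

(** With [P] the Sobolev exponent, this is [1/P = 1/p - s/N], in the form that matches powers of [S]
    and [a] in the next two proofs. *)
Lemma sobolev_exponentE s p : 0 < N%:R :> R -> s * p < N%:R ->
  sobolev_exponent N s p = p + sobolev_exponent N s p * (s * p / N%:R).
Proof.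
by move=> N0 spN; rewrite /sobolev_exponent; field; rewrite !gt_eqF// subr_gt0.
Qed.

Local Open Scope ereal_scope.

(* By Chebyshev, |u| < a := |u x| / 2 on at least half of the cube around x of
   measure 2 S / a^P. *)
Lemma sobolev_pointwise s p : (1 < p)%R -> (0 < s)%R -> (s * p < N%:R)%R ->
  let P := sobolev_exponent N s p in
  exists2 c : R, (0 < c)%R & forall u (S : R) x, measurable_fun setT u ->
    (0 < S)%R -> \int[mu]_y (`|u y| `^ P)%:E <= S%:E ->
    ((`|u x| / 2) `^ P)%:E <= (c * S `^ (s * p / N%:R))%:E *
      \int[mu]_y (gagliardo_integrand s p u (x, y))%:E.
Proof.
move=> p1 s0 spN P.
have sp0 : (0 < s * p)%R by rewrite mulr_gt0// (lt_trans _ p1).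
have N0 : (0 < N%:R :> R)%R by exact: lt_trans spN.
have p0 : (0 < p)%R by exact: lt_trans p1.
have Nsp0 : (0 < N%:R + s * p)%R by rewrite addr_gt0.
pose sg := (s * p / N%:R)%R.
have sg0 : (0 < sg)%R by rewrite divr_gt0.
have PE : (P = p + P * sg)%R by exact: sobolev_exponentE.
have P0 : (0 < P)%R by rewrite divr_gt0// ?mulr_gt0// subr_gt0.
(* With [dd = sqrt N * r] and [2 r = (2 W)^(1/N)] as chosen below,
   [dd^(N + s p) = c * W^(1 + sg)]. *)
pose c := ((Num.sqrt N%:R / 2) `^ (N%:R + s * p) * 2 `^ (1 + sg))%R.
have sN0 : (0 < Num.sqrt N%:R / 2 :> R)%R by rewrite divr_gt0// sqrtr_gt0.
have c0 : (0 < c)%R by rewrite mulr_gt0// powR_gt0.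
exists c => // u S x mu_ S0 uS.
have [ux0|ux0] := eqVneq (u x) 0%R.
  rewrite ux0 normr0 mul0r powR0 ?gt_eqF//; apply: mule_ge0.
    by rewrite lee_fin mulr_ge0 ?powR_ge0// ltW.
  by apply: integral_ge0 => y _; rewrite lee_fin gagliardo_integrand_ge0.
set a := (`|u x| / 2)%R.
have a0 : (0 < a)%R by rewrite divr_gt0// normr_gt0.
(* By Chebyshev, [W] bounds the measure of the set where [|u| >= a]; the radius [r] then gives the
   cube measure exactly [2 W]. *)
pose W := (S / a `^ P)%R.
have W0 : (0 < W)%R by rewrite divr_gt0// powR_gt0.
pose r := ((2 * W) `^ (N%:R^-1) / 2)%R.
have r0 : (0 < r)%R by rewrite divr_gt0// powR_gt0// mulr_gt0.
have Qr : mu (cube x r) = (2 * W)%:E.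
  rewrite lebesgue_cube 1?ltW// /r mulrC divfK// -powR_mulrn ?powR_ge0//.
  rewrite -powRrM mulVf ?gt_eqF// powRr1// mulr_ge0// ltW//.
have mua : measurable [set y | (a <= `|u y|)%R].
  rewrite -[X in measurable X]setTI.
  by apply: measurable_fun_ler => //; exact: measurableT_comp.
have mQa : measurable (cube x r `&` [set y | (a <= `|u y|)%R]).
  by apply: measurableI => //; exact: measurable_cube.
have mE : measurable (cube x r `\` [set y | (a <= `|u y|)%R]).
  by apply: measurableD => //; exact: measurable_cube.
have muP : measurable_fun setT (fun y => (`|u y| `^ P)%:E).
  by apply/measurable_EFinP; exact: measurable_powR_norm.
have muQa : mu (cube x r `&` [set y | (a <= `|u y|)%R]) <= W%:E.
  rewrite /W mulrC EFinM lee_pdivlMl ?powR_gt0//.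
  apply: le_trans uS.
  apply: (@le_trans _ _ (\int[mu]_(y in cube x r `&` [set y | (a <= `|u y|)%R])
      (`|u y| `^ P)%:E)).
    apply: ge0_le_integral_cst; rewrite ?powR_ge0//.
      exact: measurable_funTS.
    by move=> y [_ /= ay]; rewrite lee_fin ge0_ler_powR ?nnegrE// ltW.
  by apply: ge0_subset_integral => // y _; rewrite lee_fin powR_ge0.
have WE : W%:E <= mu (cube x r `\` [set y | (a <= `|u y|)%R]).
  rewrite -(@leeD2rE _ W%:E)// -EFinD -mulr2n -[(W *+ 2)%R]mulr_natl -Qr.
  rewrite [leLHS](measureDI _ _ mua)//; first exact: leeD2l.
  exact: measurable_cube.
pose dd := (Num.sqrt N%:R * r)%R.
have uE y : (cube x r `\` [set y | (a <= `|u y|)%R]) y ->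
    (a `^ p / dd `^ (N%:R + s * p) <= gagliardo_integrand s p u (x, y))%R.
  move=> [Qy /negP]; rewrite -ltNge => uya.
  apply: gagliardo_integrand_ge; rewrite ?(ltW p0) ?(ltW Nsp0)//.
    (* Since [|u x| = 2 a] and [|u y| < a], the two values differ by more than [a]. *)
    have := ler_distD (u y) (u x) 0%R; rewrite !subr0 => h.
    rewrite /a in uya *; lra.
  by apply: eucl_norm_cube => //; exact: ltW.
have k0 : (0 <= a `^ p / dd `^ (N%:R + s * p))%R by rewrite divr_ge0// powR_ge0.
have : (a `^ p / dd `^ (N%:R + s * p))%:E * W%:E <=
    \int[mu]_y (gagliardo_integrand s p u (x, y))%:E.
  apply: (@le_trans _ _ (\int[mu]_(y in cube x r `\` [set y | (a <= `|u y|)%R])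
      (gagliardo_integrand s p u (x, y))%:E)).
    apply: le_trans (lee_wpmul2l _ WE) _; first by rewrite lee_fin.
    apply: ge0_le_integral_cst => //.
    apply/measurable_EFinP; apply: measurable_funTS.
    exact: measurable_gagliardo_integrand2.
  apply: ge0_subset_integral => //.
    by apply/measurable_EFinP; exact: measurable_gagliardo_integrand2.
  by move=> y _; rewrite lee_fin gagliardo_integrand_ge0.
have ddE : (dd `^ (N%:R + s * p) = c * (W * W `^ sg))%R.
  rewrite (_ : dd = Num.sqrt N%:R / 2 * (2 * W) `^ N%:R^-1)%R; last first.
    by rewrite /dd /r; ring.
  rewrite [LHS]powRM ?powR_ge0 ?(ltW sN0)// -powRrM.
  rewrite (_ : N%:R^-1 * _ = 1 + sg)%R; last first.
    by rewrite /sg; field; rewrite gt_eqF.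
  rewrite powRM ?(ltW W0)// [(W `^ _)%R]powRD ?powRr1 ?(ltW W0) ?(gt_eqF W0) ?implybT//.
  by rewrite /c; ring.
have SE : (S `^ sg = W `^ sg * a `^ (P * sg))%R.
  rewrite powRrM -powRM ?powR_ge0 ?(ltW W0)// /W divfK//.
  by rewrite gt_eqF// powR_gt0.
have aE : (a `^ P = a `^ p * a `^ (P * sg))%R.
  by rewrite [in LHS]PE powRD// (gt_eqF a0) implybT.
(* All powers of [W] cancel: [S^sg] contributes [W^sg], the measure contributes [W], and
   [dd^(N + s p)] is [c * W^(1 + sg)]. The powers of [a] match by [PE]. *)
have -> : (a `^ P = c * S `^ sg * (a `^ p / dd `^ (N%:R + s * p) * W))%R.
  rewrite ddE aE SE; field.
  by rewrite !gt_eqF// powR_gt0.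
move=> h; rewrite EFinM; apply: lee_wpmul2l => //.
by rewrite lee_fin mulr_ge0 ?powR_ge0// ltW.
Qed.

(* Integrating sobolev_pointwise gives S <= C S^(s p / N) [u]^p, and S < oo
   can be divided out. *)
Lemma fractional_sobolev s p : (1 < p)%R -> (0 < s)%R -> (s * p < N%:R)%R ->
  let P := sobolev_exponent N s p in
  exists2 C : R, (0 < C)%R & forall u (t : R), measurable_fun setT u ->
    (0 <= t)%R -> \int[mu]_y (`|u y| `^ P)%:E < +oo ->
    \int[mu \x mu]_z (gagliardo_integrand s p u z)%:E <= (t `^ p)%:E ->
    \int[mu]_y (`|u y| `^ P)%:E <= (C * t `^ P)%:E.
Proof.
move=> p1 s0 spN P.
have sp0 : (0 < s * p)%R by rewrite mulr_gt0// (lt_trans _ p1).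
have N0 : (0 < N%:R :> R)%R by exact: lt_trans spN.
have p0 : (0 < p)%R by exact: lt_trans p1.
pose sg := (s * p / N%:R)%R.
have sg1 : (0 < 1 - sg)%R by rewrite subr_gt0 /sg ltr_pdivrMr// mul1r.
have PE : (P = p + P * sg)%R by exact: sobolev_exponentE.
have P0 : (0 < P)%R by rewrite divr_gt0// ?mulr_gt0// subr_gt0.
have [c c0 hc] := sobolev_pointwise _ _ p1 s0 spN.
(* The inequality to solve is [S^(1 - sg) <= 2^P * c * t^p]; raising it to the power [1/(1 - sg)]
   gives [t^P], because [p/(1 - sg) = P]. *)
exists ((2 `^ P * c) `^ (1 - sg)^-1)%R; first by rewrite powR_gt0// mulr_gt0// powR_gt0.
move=> u t mu_ t0 ufin Gt.
have muP : measurable_fun setT (fun y => (`|u y| `^ P)%:E).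
  by apply/measurable_EFinP; exact: measurable_powR_norm.
have I0 : 0 <= \int[mu]_y (`|u y| `^ P)%:E.
  by apply: integral_ge0 => y _; rewrite lee_fin powR_ge0.
have /fineK IE : \int[mu]_y (`|u y| `^ P)%:E \is a fin_num.
  by rewrite ge0_fin_numE.
set S := fine _ in IE.
(* The division by [S^sg] below takes place with [S > 0]. *)
have [S0|S0] := leP S 0%R.
  by rewrite -IE lee_fin (le_trans S0)// mulr_ge0 ?powR_ge0.
have mg : measurable_fun setT (fun z => (gagliardo_integrand s p u z)%:E).
  by apply/measurable_EFinP; exact: measurable_gagliardo_integrand.
have g0 z : 0 <= (gagliardo_integrand s p u z)%:E.
  by rewrite lee_fin gagliardo_integrand_ge0.
have hS : (2 `^ P)^-1%:E * S%:E <= (c * S `^ sg)%:E * (t `^ p)%:E.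
  have cS : (0 <= c * S `^ sg)%R by rewrite mulr_ge0 ?powR_ge0// ltW.
  apply: le_trans (lee_wpmul2l _ Gt); last by rewrite lee_fin.
  rewrite fubini_tonelli1// IE.
  rewrite -ge0_integralZl ?lee_fin ?invr_ge0 ?powR_ge0//.
  rewrite -ge0_integralZl//; last 2 first.
  - exact: measurable_fun_fubini_tonelli_F.
  - by move=> x _; apply: integral_ge0.
  apply: ge0_le_integral => //.
  - exact: measurable_funeM.
  - apply: measurable_funeM; exact: measurable_fun_fubini_tonelli_F.
  move=> x _.
  have := hc u S x mu_ S0; rewrite -IE lexx => /(_ isT).
  have -> : ((2 `^ P)^-1 = 2^-1 `^ P :> R)%R.
    by rewrite -powRN -mulN1r powRrM powR_inv1.
  by rewrite powRM// ?invr_ge0// EFinM muleC.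
move: hS; rewrite -!EFinM -IE !lee_fin => hS.
have {}hS : (S `^ (1 - sg) <= 2 `^ P * c * t `^ p)%R.
  rewrite powRB ?(gt_eqF S0) ?implybT// powRr1 ?(ltW S0)//.
  rewrite ler_pdivrMr ?powR_gt0//.
  rewrite -(@ler_pM2l _ (2 `^ P)^-1%R) ?invr_gt0 ?powR_gt0//.
  apply: le_trans hS _; rewrite le_eqVlt; apply/orP; left; apply/eqP.
  by field; rewrite gt_eqF// powR_gt0.
have -> : (S = (S `^ (1 - sg)) `^ (1 - sg)^-1)%R.
  by rewrite -powRrM divff ?gt_eqF// powRr1// ltW.
have -> : (t `^ P = (t `^ p) `^ (1 - sg)^-1)%R.
  rewrite -powRrM; congr (_ `^ _)%R.
  apply: (mulIf (negbT (gt_eqF sg1))); rewrite divfK ?gt_eqF//.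
  by rewrite mulrBr mulr1 {1}PE addrK.
rewrite -powRM ?powR_ge0//; last by rewrite mulr_ge0 ?powR_ge0// ltW.
apply: ge0_ler_powR => //; rewrite ?nnegrE ?powR_ge0//.
- by rewrite invr_ge0 ltW.
- by rewrite !mulr_ge0 ?powR_ge0// ltW.
Qed.

End gagliardo_sobolev.

(** * Elementary inequalities between powers *)

Section interpolation.
Context {R : realType}.
Implicit Types (p q P a v w : R).

(** Each base is at most [x + y], and the exponents add up to 1. *)
Lemma powR_interp_le a x y : 0 <= a <= 1 -> 0 <= x -> 0 <= y ->
  x `^ a * y `^ (1 - a) <= x + y :> R.
Proof.
move=> /andP[a0 a1] x0 y0.
have xy0 : 0 <= x + y by rewrite addr_ge0.
have -> : x + y = (x + y) `^ a * (x + y) `^ (1 - a).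
  by rewrite -powRD subrKC ?oner_eq0// powRr1.
apply: ler_pM; rewrite ?powR_ge0// ge0_ler_powR ?nnegrE ?subr_ge0//.
- by rewrite lerDl.
- by rewrite lerDr.
Qed.

(** With [a = (P - q)/(P - p)] one has [q = a p + (1 - a) P], so the left side is the product of
    [(v w^p)^a] and [(w^P)^(1 - a)]. *)
Lemma weighted_powR_interp_le p q P v w : 0 < p -> p < q -> q < P ->
  0 <= v -> 0 <= w ->
  v `^ ((P - q) / (P - p)) * w `^ q <= v * w `^ p + w `^ P.
Proof.
move=> p0 pq qP v0; rewrite le_eqVlt => /predU1P[<-|w0].
  have q0 := lt_trans p0 pq.
  by rewrite !powR0 ?gt_eqF ?mulr0 ?addr0//; exact: lt_trans qP.
have Pp : 0 < P - p by rewrite subr_gt0 (lt_trans pq).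
set a := (P - q) / (P - p).
have a01 : 0 <= a <= 1.
  apply/andP; split; first by rewrite divr_ge0 ?subr_ge0// ltW// -subr_gt0.
  by rewrite ler_pdivrMr// mul1r lerB// ltW.
apply: le_trans (powR_interp_le _ (v * w `^ p) (w `^ P) a01 _ _).
- rewrite powRM ?powR_ge0// -mulrA -!powRrM -powRD ?(gt_eqF w0) ?implybT//.
  rewrite le_eqVlt; apply/orP; left; apply/eqP; congr (_ * _ `^ _).
  by rewrite /a; field; rewrite gt_eqF.
- by rewrite mulr_ge0 ?powR_ge0.
- by rewrite powR_ge0.
Qed.

(** The threshold [th] satisfies [th^(-(P - q)) = e]. Above it, [w^q = w^P w^(-(P - q))] is at most
    [e w^P]; below it, [w^(q - p)] is at most the constant [th^(q - p)]. *)
Lemma powR_split_le p q P (e : R) : 0 < p -> p < q -> q < P -> 0 < e ->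
  exists2 C : R, 0 <= C & forall w, 0 <= w ->
    w `^ q <= e * w `^ P + C * w `^ p.
Proof.
move=> p0 pq qP e0; have Pq : 0 < P - q by rewrite subr_gt0.
have th0 : 0 < e `^ (- (P - q)^-1) by rewrite powR_gt0.
have thE : (e `^ (- (P - q)^-1)) `^ (- (P - q)) = e.
  by rewrite -powRrM mulrNN mulVf ?gt_eqF// powRr1// ltW.
move: (e `^ _) th0 thE => th th0 thE.
exists (th `^ (q - p)); first exact: powR_ge0.
move=> w; rewrite le_eqVlt => /predU1P[<-|w0].
  rewrite powR0 ?gt_eqF ?(lt_trans p0)// addr_ge0// mulr_ge0 ?powR_ge0//.
  exact: ltW.
have [wth|thw] := leP w th.
  have -> : w `^ q = w `^ (q - p) * w `^ p.
    by rewrite -powRD ?subrK// (gt_eqF w0) implybT.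
  apply: ler_wpDl; first by rewrite mulr_ge0 ?powR_ge0// ltW.
  rewrite ler_wpM2r ?powR_ge0//.
  by rewrite ge0_ler_powR// ?nnegrE ?subr_ge0 ?ltW.
apply: ler_wpDr; first by rewrite mulr_ge0 ?powR_ge0.
rewrite (_ : q = P - (P - q)); last by ring.
rewrite powRB ?(gt_eqF w0) ?implybT// mulrC.
rewrite ler_wpM2r ?powR_ge0// -thE powRN.
rewrite lef_pV2 ?posrE ?powR_gt0//.
by rewrite ge0_ler_powR ?nnegrE// ltW.
Qed.

(** The sum is at most twice the larger modulus; unlike convexity, this argument covers every
    [p >= 0]. *)
Lemma powR_normD_le p (x y : R) : 0 <= p ->
  `|x + y| `^ p <= 2 `^ p * (`|x| `^ p + `|y| `^ p).
Proof.
move=> p0; have [xy|/ltW yx] := leP `|x| `|y|.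
  apply: (@le_trans _ _ ((2 * `|y|) `^ p)).
    rewrite ge0_ler_powR ?nnegrE ?mulr_ge0//.
    by rewrite (le_trans (ler_normD _ _))// mulr_natl mulr2n lerD2r.
  by rewrite powRM// ler_wpM2l ?powR_ge0// lerDr powR_ge0.
apply: (@le_trans _ _ ((2 * `|x|) `^ p)).
  rewrite ge0_ler_powR ?nnegrE ?mulr_ge0//.
  by rewrite (le_trans (ler_normD _ _))// mulr_natl mulr2n lerD2l.
by rewrite powRM// ler_wpM2l ?powR_ge0// lerDl powR_ge0.
Qed.

End interpolation.

(** * Domination of [K] and [L] by [V] outside and inside large boxes *)

Section weights.
Context {R : realType} {N : nat}.
Implicit Types (V K L : 'rV[R]_N -> R) (x : 'rV[R]_N) (p q P : R).

(** Half-open, so that translated cells tile a box without overlap. *)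
Definition hcell (a : 'rV[R]_N) (h : R) : set 'rV[R]_N :=
  [set x | forall i, a 0 i <= x 0 i < a 0 i + h].

Definition hbox (r : R) : set 'rV[R]_N := hcell (const_mx (- r)) (2 * r).

Lemma measurable_hcell a h : measurable (hcell a h).
Proof.
rewrite (_ : hcell a h =
    [set y | forall i, `[a 0 i, a 0 i + h[%classic (y 0 i)]).
  apply: (@measurable_rV_forall _ _ (fun i => `[a 0 i, a 0 i + h[%classic)) => i.
  exact: measurable_itv.
by apply/seteqP; split => y /= H i; have := H i; rewrite in_itv.
Qed.

Lemma hboxP r x : hbox r x <-> forall i, - r <= x 0 i < r.
Proof.
split=> H i; have := H i; rewrite !mxE.
  by move=> /andP[? ?]; apply/andP; split; lra.
by move=> /andP[? ?]; apply/andP; split; lra.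
Qed.

Lemma notin_hbox r x : ~ hbox r x -> r <= eucl_norm x.
Proof.
move=> /hboxP/existsNP[i /negP]; rewrite negb_and -!ltNge => h.
apply: le_trans (coord_le_eucl_norm x i).
by rewrite ler_normr; case/orP: h => h; apply/orP; [right|left]; lra.
Qed.

Lemma eucl_norm_lt_hbox r x : eucl_norm x < r -> hbox r x.
Proof.
move=> xr; apply/hboxP => i.
have := le_lt_trans (coord_le_eucl_norm x i) xr.
by rewrite ltr_norml => /andP[/ltW -> ->].
Qed.

Lemma le_hbox (r r' : R) : r <= r' -> hbox r `<=` hbox r'.
Proof.
move=> rr' x /hboxP xr; apply/hboxP => i; have /andP[? ?] := xr i.
by apply/andP; split; lra.
Qed.

Lemma hbox_continuous_bounded (f : 'rV[R]_N -> R) r : continuous f ->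
  exists M : R, forall x, hbox r x -> `|f x| <= M.
Proof.
move=> cf.
have cB : compact [set x : 'rV[R]_N | forall i, `[- r, r]%classic (x 0 i)].
  apply: (@rV_compact _ _ (fun=> `[- r, r]%classic)) => i.
  exact: segment_compact.
have /compact_bounded[M [_ hM]] := continuous_compact (continuous_subspaceT cf) cB.
exists (M + 1) => x /hboxP xr; apply: (hM (M + 1)); first by rewrite ltrDl.
exists x => // i /=; have /andP[? ?] := xr i.
by rewrite in_itv/=; apply/andP; split; lra.
Qed.

(** The continuous function [1/V] is bounded on the box. *)
Lemma hbox_continuous_gt0 V r : continuous V -> (forall x, 0 < V x) ->
  exists2 c : R, 0 < c & forall x, hbox r x -> c <= V x.
Proof.
move=> cV V0.
have cV' : continuous (fun x => (V x)^-1).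
  by move=> x; exact: cvgV (lt0r_neq0 (V0 x)) (cV x).
have [M hM] := hbox_continuous_bounded _ r cV'.
exists (`|M| + 1)^-1; first by rewrite invr_gt0 ltr_wpDl.
move=> x /hM; rewrite gtr0_norm ?invr_gt0// => VM.
rewrite -[leRHS]invrK lef_pV2 ?posrE ?invr_gt0//.
by rewrite (le_trans VM)// (le_trans (ler_norm _))// lerDl.
Qed.

(** Stated for all boxes of radius at least [r], so that the radii given by two limits can be
    replaced by their maximum. *)
Lemma cvg_eucl_infty0_le (f g : 'rV[R]_N -> R) (e : R) : 0 < e ->
  (forall x, 0 < g x) -> f x / g x @[x --> eucl_infty R N] --> 0 ->
  exists2 r : R, 0 < r & forall r' x, r <= r' -> ~ hbox r' x -> f x <= e * g x.
Proof.
move=> e0 g0 /cvgr0_norm_lt/(_ _ e0)[M _ hM].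
exists (`|M| + 1); first by rewrite ltr_wpDl.
move=> r' x rr' /notin_hbox xr.
have /hM/= : M < eucl_norm x.
  rewrite (lt_le_trans _ xr)// (lt_le_trans _ rr')//.
  by rewrite (le_lt_trans (ler_norm _))// ltrDl.
move=> /ltW; rewrite -ler_pdivrMr//; apply: le_trans; exact: ler_norm.
Qed.

Lemma weights_le V K L p q P (e : R) : 0 < p -> p < q -> q < P ->
  (forall x, 0 < V x) -> bounded_fun K -> bounded_fun L ->
  K x / V x @[x --> eucl_infty R N] --> 0 ->
  L x / V x `^ ((P - q) / (P - p)) @[x --> eucl_infty R N] --> 0 ->
  0 < e ->
  exists r C : R, 0 <= C /\ forall x (w : R), 0 <= w ->
    K x * w `^ p + L x * w `^ q <=
    e * (V x * w `^ p + w `^ P) + C * (\1_(hbox r) x * w `^ p).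
Proof.
move=> p0 pq qP V0 [MK [_ hK]] [ML [_ hL]] cK cL e0.
have e20 : 0 < e / 2 by rewrite divr_gt0.
have [r1 r10 h1] := cvg_eucl_infty0_le _ _ _ e20 V0 cK.
have Va0 x : 0 < V x `^ ((P - q) / (P - p)) by rewrite powR_gt0.
have [r2 r20 h2] := cvg_eucl_infty0_le _ _ _ e20 Va0 cL.
pose M : R := `|MK| + `|ML| + 1.
have M0 : 0 < M by rewrite ltr_wpDl// addr_ge0.
have KM x : K x <= M.
  apply: le_trans (ler_norm _) _; apply: hK => //.
  by rewrite /M -addrA (le_lt_trans (ler_norm _))// ltrDl ltr_wpDl.
have LM x : L x <= M.
  apply: le_trans (ler_norm _) _; apply: hL => //.
  rewrite /M addrAC (le_lt_trans (ler_norm _))// addrC ltrDl ltr_wpDl//.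
(* Inside the box [L] is at most [M], so splitting [w^q] with parameter [e / M] makes [M w^q] cost
   [e w^P]. *)
have eM0 : 0 < e / M by rewrite divr_gt0.
have [C C0 hC] := powR_split_le _ _ _ _ p0 pq qP eM0.
exists (Num.max r1 r2), (M + M * C); split.
  by rewrite addr_ge0 ?mulr_ge0// ltW.
move=> x w w0.
have wp := powR_ge0 w p; have wq := powR_ge0 w q; have wP := powR_ge0 w P.
have Vwp : 0 <= V x * w `^ p by rewrite mulr_ge0// ltW.
rewrite indicE; have [/set_mem xr|/negP/(contra_not (@mem_set _ _ _)) xr] :=
  boolP (x \in hbox _); last first.
  rewrite mul0r mulr0 addr0.
  have Kx := h1 _ _ _ xr; have Lx := h2 _ _ _ xr.
  have {}Kx : K x <= e / 2 * V x by apply: Kx; rewrite le_max lexx.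
  have {}Lx : L x <= e / 2 * V x `^ ((P - q) / (P - p)).
    by apply: Lx; rewrite le_max lexx orbT.
  have I := weighted_powR_interp_le _ _ _ _ _ p0 pq qP (ltW (V0 x)) w0.
  (* Outside the box the [K] term costs [e/2] times [V w^p]; interpolation bounds the [L] term by
     [e/2] times [V w^p + w^P]. *)
  apply: (@le_trans _ _ (e / 2 * V x * w `^ p +
      e / 2 * V x `^ ((P - q) / (P - p)) * w `^ q)).
    by apply: lerD; rewrite ler_wpM2r.
  rewrite -[e / 2 * V x * _]mulrA -[X in _ + X]mulrA -mulrDr.
  rewrite [leRHS](_ : _ = e / 2 * (2 * (V x * w `^ p + w `^ P))); last by field.
  rewrite ler_pM2l//; lra.
rewrite mul1r.
apply: (@le_trans _ _ (M * w `^ p + M * (e / M * w `^ P + C * w `^ p))).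
  apply: lerD; first by rewrite ler_wpM2r.
  by apply: (@le_trans _ _ (M * w `^ q)); rewrite ?ler_wpM2r// ler_pM2l// hC.
have -> : M * (e / M * w `^ P + C * w `^ p) = e * w `^ P + M * C * w `^ p.
  by field; rewrite gt_eqF.
rewrite -subr_ge0 (_ : _ - _ = e * (V x * w `^ p)); last by ring.
by rewrite mulr_ge0// ltW.
Qed.

(** Take [e = 1] in [weights_le]; on the box [V >= c > 0], so the remainder is absorbed into
    [V w^p]. *)
Lemma weights_le_global V K L p q P : 0 < p -> p < q -> q < P ->
  (forall x, 0 < V x) -> continuous V -> bounded_fun K -> bounded_fun L ->
  K x / V x @[x --> eucl_infty R N] --> 0 ->
  L x / V x `^ ((P - q) / (P - p)) @[x --> eucl_infty R N] --> 0 ->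
  exists2 C : R, 0 <= C & forall x (w : R), 0 <= w ->
    K x * w `^ p + L x * w `^ q <= C * (V x * w `^ p + w `^ P).
Proof.
move=> p0 pq qP V0 cV bK bL cK cL.
have [r [C [C0 hC]]] := weights_le _ _ _ _ _ _ _ p0 pq qP V0 bK bL cK cL ltr01.
have [c c0 hc] := hbox_continuous_gt0 _ r cV V0.
exists (1 + C / c); first by rewrite addr_ge0// divr_ge0// ltW.
move=> x w w0; apply: le_trans (hC x w w0) _.
have wp := powR_ge0 w p; have wP := powR_ge0 w P.
have Vwp : 0 <= V x * w `^ p by rewrite mulr_ge0// ltW.
rewrite mulrDl lerD2l -mulrA ler_wpM2l// [leRHS]mulrC ler_pdivlMr// indicE.
have [/set_mem xr|_] := boolP (x \in hbox _).
  by rewrite mul1r mulrC ler_wpDr// ler_wpM2r// hc.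
by rewrite !mul0r addr_ge0.
Qed.

End weights.

(** * Partition of a box into small cells *)

Section grid.
Context {R : realType} {N : nat}.
Local Notation mu := (@lebesgue_rV R N).
Implicit Types (a x y : 'rV[R]_N) (h : R).

(** The cell contains a closed cube of side [h/2], whose measure is known exactly; the lost factor
    only enters constants. *)
Lemma lebesgue_hcell_ge a h : 0 < h ->
  (((h / 2) ^+ N)%:E <= mu (hcell a h))%E.
Proof.
move=> h0; have h40 : 0 <= h / 4 by rewrite divr_ge0// ltW.
rewrite (_ : h / 2 = 2 * (h / 4)); last by field.
rewrite -(lebesgue_cube (a + const_mx (h / 4)))//.
apply: le_measure; rewrite ?inE; [exact: measurable_cube|exact: measurable_hcell|].
by move=> x xa i; have := xa i; rewrite !mxE => /andP[? ?]; apply/andP; split; lra.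
Qed.

Lemma lebesgue_hcell_lty a h : 0 < h -> (mu (hcell a h) < +oo)%E.
Proof.
move=> h0; have h20 : 0 <= h / 2 by rewrite divr_ge0// ltW.
apply: (@le_lt_trans _ _ (mu (cube (a + const_mx (h / 2)) (h / 2)))).
  apply: le_measure; rewrite ?inE; [exact: measurable_hcell|exact: measurable_cube|].
  by move=> x xa i; have := xa i; rewrite !mxE => /andP[? ?]; apply/andP; split; lra.
by rewrite lebesgue_cube// ltry.
Qed.

Lemma eucl_norm_hcell a h x y : 0 < h -> hcell a h x -> hcell a h y ->
  eucl_norm (x - y) <= Num.sqrt N%:R * h.
Proof.
move=> h0 xa ya; rewrite -[X in _ * X]gtr0_norm//; apply: eucl_norm_le => i.
have := xa i; have := ya i; rewrite !mxE ler_norml => /andP[? ?] /andP[? ?].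
by apply/andP; split; lra.
Qed.

Definition grid_cell a h M (f : {ffun 'I_N -> 'I_M}) : set 'rV[R]_N :=
  hcell (a + \row_i ((f i)%:R * h)) h.

(** Membership says that [f i] is the integer part of [(x 0 i - a 0 i) / h]; covering and
    disjointness both follow from this. *)
Lemma grid_cellP a h M f x : 0 < h ->
  grid_cell a h M f x <->
  forall i, (f i)%:R <= (x 0 i - a 0 i) / h < (f i).+1%:R.
Proof.
move=> h0; split=> H i; have := H i; rewrite !mxE ler_pdivlMr// ltr_pdivrMr//;
  rewrite -natr1 mulrDl mul1r => /andP[? ?]; apply/andP; split; lra.
Qed.

Lemma hcell_grid a h M : 0 < h ->
  hcell a (M%:R * h) = \big[setU/set0]_(f : {ffun 'I_N -> 'I_M}) grid_cell a h M f.
Proof.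
move=> h0; rewrite -bigcup_seq; apply/seteqP; split=> [x xa|x [f _]]; last first.
  move/(grid_cellP _ _ _ _ _ h0) => H i; have /andP[lo up] := H i.
  rewrite ler_pdivlMr// in lo; rewrite ltr_pdivrMr// in up.
  have : (f i).+1%:R * h <= M%:R * h by rewrite ler_pM2r// ler_nat.
  have : 0 <= (f i)%:R * h by rewrite mulr_ge0// ltW.
  by move=> ? ?; apply/andP; split; lra.
have t0 i : 0 <= (x 0 i - a 0 i) / h.
  by have /andP[? _] := xa i; rewrite divr_ge0 ?subr_ge0// ltW.
have tM i : (Num.truncn ((x 0 i - a 0 i) / h)%R < M)%N.
  rewrite -(ltr_nat R); have /andP[lo _] := truncn_itv (t0 i).
  apply: le_lt_trans lo _; rewrite ltr_pdivrMr//.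
  by have /andP[_ ?] := xa i; lra.
exists [ffun i => Ordinal (tM i)]; first by rewrite /= mem_index_enum.
apply/grid_cellP => // i; rewrite ffunE /=.
by have /andP[-> ->] := truncn_itv (t0 i).
Qed.

Lemma trivIset_grid a h M : 0 < h -> trivIset setT (grid_cell a h M).
Proof.
move=> h0 f g _ _ [x [/(grid_cellP _ _ _ _ _ h0) xf /(grid_cellP _ _ _ _ _ h0) xg]].
apply/ffunP => i; apply: val_inj.
by rewrite /= -(truncn_def (xf i)) (truncn_def (xg i)).
Qed.

Lemma ge0_integral_grid a h M (F : 'rV[R]_N -> \bar R) : 0 < h ->
  measurable_fun setT F -> (forall x, 0 <= F x)%E ->
  (\int[mu]_(x in hcell a (M%:R * h)) F x =
   \sum_(f : {ffun 'I_N -> 'I_M}) \int[mu]_(x in grid_cell a h M f) F x)%E.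
Proof.
move=> h0 mF F0; rewrite hcell_grid// ge0_integral_bigsetU//.
- by move=> f; exact: measurable_hcell.
- exact: index_enum_uniq.
- exact: sub_trivIset (trivIset_grid _ _ _ h0).
- exact: measurable_funTS.
Qed.

End grid.

(** Compactness of the segment gives a cluster point. An ultrafilter contains each neighbourhood of
    it or the complement, and the complement would contradict clustering. *)
Lemma ultra_bounded_cvg (R : realType) (U : set_system nat) (c : nat -> R) (B : R) :
  UltraFilter U -> (forall k, `|c k| <= B) -> exists l : R, c @ U --> l.
Proof.
move=> UU cB.
have Bc : (c @ U) `[- B, B]%classic.
  by apply: (@filterE _ U) => k; rewrite /= in_itv/= -ler_norml.
have cB' : compact `[- B, B]%classic by exact: segment_compact.
have [l [_ lc]] := cB' _ _ Bc.
exists l => W lW; have [//|cW] := in_ultra_setVsetC (c @^-1` W) UU.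
by have [y [nWy Wy]] := lc (~` W) W cW lW; case: (nWy Wy).
Qed.

(** * Local compactness from a Poincaré estimate on cells *)

Section local_compactness.
Context {R : realType} {N : nat}.
Local Notation mu := (@lebesgue_rV R N).
Implicit Types (u : 'rV[R]_N -> R) (p s : R).
Local Open Scope ereal_scope.

(** Energy density at [x], with [y] ranging over the whole space: the shares of disjoint cells add
    up to at most the total energy. *)
Local Notation fiber s p u x := (\int[mu]_y (gagliardo_integrand s p u (x, y))%:E).

Lemma gagliardo_fiber_ge0 s p u x : 0 <= fiber s p u x.
Proof. by apply: integral_ge0 => y _; rewrite lee_fin gagliardo_integrand_ge0. Qed.

Lemma measurable_gagliardo_fiber s p u : measurable_fun setT u ->
  measurable_fun setT (fun x => fiber s p u x).
Proof.
move=> mu_; apply: (@measurable_fun_fubini_tonelli_F _ _ _ _ _ mu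
    (fun z => (gagliardo_integrand s p u z)%:E)) => [|z].
  by apply/measurable_EFinP; exact: measurable_gagliardo_integrand.
by rewrite lee_fin gagliardo_integrand_ge0.
Qed.

Lemma integral_gagliardo_fiber s p u : measurable_fun setT u ->
  \int[mu]_x fiber s p u x = \int[mu \x mu]_z (gagliardo_integrand s p u z)%:E.
Proof.
move=> mu_; rewrite [RHS]fubini_tonelli1//.
  by apply/measurable_EFinP; exact: measurable_gagliardo_integrand.
by move=> z; rewrite lee_fin gagliardo_integrand_ge0.
Qed.

(** Off the diagonal the denominator is at most [d^(N + s p)]; on the diagonal both sides are 0. *)
Lemma powR_dist_le_gagliardo s p u x y (d : R) :
  (0 < p)%R -> (0 <= N%:R + s * p)%R -> (eucl_norm (x - y) <= d)%R ->
  (`|u x - u y| `^ p <=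
    d `^ (N%:R + s * p) * gagliardo_integrand s p u (x, y))%R.
Proof.
move=> p0 e0 xyd; rewrite /gagliardo_integrand/=.
have [/eucl_norm_eq0/eqP|xy0] := eqVneq (eucl_norm (x - y)) 0%R.
  rewrite subr_eq0 => /eqP ->; rewrite !subrr normr0 powR0 ?gt_eqF// mul0r mulr0//.
have xyp : (0 < eucl_norm (x - y))%R by rewrite lt_neqAle eq_sym xy0 eucl_norm_ge0.
rewrite mulrCA ler_peMr ?powR_ge0// ler_pdivlMr ?powR_gt0// mul1r.
by rewrite ge0_ler_powR// nnegrE ?eucl_norm_ge0// (le_trans _ xyd)// ltW.
Qed.

Lemma integral_weight_powR_split_le (D : set 'rV[R]_N) p
    (W u v w : 'rV[R]_N -> R) :
  (0 <= p)%R -> measurable D -> (forall x, 0 <= W x)%R ->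
  measurable_fun setT W -> measurable_fun setT v -> measurable_fun setT w ->
  (forall x, u x = v x + w x)%R ->
  \int[mu]_(x in D) (W x * `|u x| `^ p)%:E <=
  (2 `^ p)%:E * (\int[mu]_(x in D) (W x * `|v x| `^ p)%:E +
                 \int[mu]_(x in D) (W x * `|w x| `^ p)%:E).
Proof.
move=> p0 mD W0 mW mv mw uvw; under eq_integral do rewrite uvw.
have m (f : 'rV[R]_N -> R) : measurable_fun setT f ->
    measurable_fun D (fun x => (W x * `|f x| `^ p)%:E).
  move=> mf; apply/measurable_EFinP; apply: measurable_funTS.
  by apply: measurable_funM => //; exact: measurable_powR_norm.
have f0 (f : 'rV[R]_N -> R) x : 0 <= (W x * `|f x| `^ p)%:E.
  by rewrite lee_fin mulr_ge0 ?powR_ge0.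
rewrite -ge0_integralD//; [|exact: m|exact: m].
rewrite -ge0_integralZl//; last 2 first.
- by apply: emeasurable_funD; exact: m.
- by move=> x _; rewrite adde_ge0.
apply: ge0_le_integral => //.
- by move=> x _; exact: (f0 (fun x => v x + w x)%R).
- by apply: m; exact: measurable_funD.
- by apply: measurable_funeM; apply: emeasurable_funD; exact: m.
- move=> x _; rewrite -EFinD -EFinM lee_fin -mulrDr mulrCA ler_wpM2l//.
  exact: powR_normD_le.
Qed.

Lemma integral_powR_split_le (D : set 'rV[R]_N) p (u v w : 'rV[R]_N -> R) :
  (0 <= p)%R -> measurable D -> measurable_fun setT v -> measurable_fun setT w ->
  (forall x, u x = v x + w x)%R ->
  \int[mu]_(x in D) (`|u x| `^ p)%:E <=
  (2 `^ p)%:E * (\int[mu]_(x in D) (`|v x| `^ p)%:E +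
                 \int[mu]_(x in D) (`|w x| `^ p)%:E).
Proof.
move=> p0 mD mv mw uvw.
have one (f : 'rV[R]_N -> R) : \int[mu]_(x in D) (`|f x| `^ p)%:E =
    \int[mu]_(x in D) (cst 1%R x * `|f x| `^ p)%:E.
  by apply: eq_integral => x _; rewrite mul1r.
by rewrite !one; apply: integral_weight_powR_split_le.
Qed.

(* A point with small fiber replaces the mean value in the Poincare inequality. *)
Lemma exists_cell_center s p u a (h A : R) :
  (0 < p)%R -> (0 <= N%:R + s * p)%R -> (0 < h)%R -> (0 <= A)%R ->
  measurable_fun setT u ->
  \int[mu]_(x in hcell a h) fiber s p u x < A%:E * mu (hcell a h) ->
  exists c : R, \int[mu]_(y in hcell a h) (`|u y - c| `^ p)%:E <=
    ((Num.sqrt N%:R * h) `^ (N%:R + s * p) * A)%:E.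
Proof.
move=> p0 e0 h0 A0 mu_ IA; set d := (Num.sqrt N%:R * h)%R.
have [||x xa FA] := exists_lt_integral _ _ _ _ _ _ _ _ _ A0 IA.
- exact: measurable_hcell.
- by apply: measurable_funTS; exact: measurable_gagliardo_fiber.
have mg : measurable_fun setT (fun y => (gagliardo_integrand s p u (x, y))%:E).
  by apply/measurable_EFinP; exact: measurable_gagliardo_integrand2.
have d0 : 0 <= (d `^ (N%:R + s * p))%:E by rewrite lee_fin powR_ge0.
exists (u x); rewrite EFinM; apply: le_trans (lee_wpmul2l d0 (ltW FA)).
rewrite -ge0_integralZl//; last first.
  by move=> y _; rewrite lee_fin gagliardo_integrand_ge0.
apply: (@le_trans _ _ (\int[mu]_(y in hcell a h)
    ((d `^ (N%:R + s * p))%:E * (gagliardo_integrand s p u (x, y))%:E))).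
  apply: ge0_le_integral.
  - exact: measurable_hcell.
  - by move=> y _; rewrite lee_fin powR_ge0.
  - apply/measurable_EFinP/measurable_funTS/measurable_powR_norm.
    exact: measurable_funB.
  - by apply: measurable_funTS; exact: measurable_funeM.
  - move=> y ya; rewrite -EFinM lee_fin distrC.
    by apply: powR_dist_le_gagliardo => //; exact: eucl_norm_hcell xa ya.
apply: ge0_subset_integral => //.
- exact: measurable_hcell.
- exact: measurable_funeM.
- by move=> y _; rewrite mule_ge0// lee_fin gagliardo_integrand_ge0.
Qed.

(** Comes from a diameter bound [sqrt N * h] and the lower bound [(h/2)^N] on the measure of a cell
    of side [h]. *)
Local Notation poincare_cst s p h :=
  (2 `^ p * ((Num.sqrt N%:R * h) `^ (N%:R + s * p) / (h / 2) ^+ N))%R.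

(** The values at the cell centres are bounded, hence converge along [U]; their limit [l] can
    replace them at a small cost. *)
Lemma ultra_cell_limit (U : set_system nat) s p (u : nat -> 'rV[R]_N -> R) a
    (h B G e : R) : UltraFilter U ->
  (0 < N%:R :> R)%R -> (0 < p)%R -> (0 < s)%R -> (0 < h)%R -> (0 < e)%R ->
  (forall k, measurable_fun setT (u k)) ->
  (forall k, \int[mu]_(x in hcell a h) (`|u k x| `^ p)%:E <= B%:E) ->
  (forall k, \int[mu]_(x in hcell a h) fiber s p (u k) x <= G%:E) ->
  exists l : R, \forall k \near U,
    \int[mu]_(x in hcell a h) (`|u k x - l| `^ p)%:E <=
    (poincare_cst s p h)%:E * \int[mu]_(x in hcell a h) fiber s p (u k) x + e%:E.
Proof.
move=> UU N0 p0 s0 h0 e0 mu_ uB uG.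
have ex0 : (0 <= N%:R + s * p)%R by rewrite addr_ge0 ?mulr_ge0 ?(ltW s0) ?(ltW p0).
set D := (_ `^ (N%:R + s * p))%R.
have D0 : (0 < D)%R by rewrite powR_gt0// mulr_gt0// sqrtr_gt0.
have h2N : (0 < (h / 2) ^+ N)%R by rewrite exprn_gt0// divr_gt0.
have pp : (0 < 2 `^ p :> R)%R by rewrite powR_gt0.
have mQ : measurable (hcell a h) by exact: measurable_hcell.
have [m mE mh] : exists2 m : R, mu (hcell a h) = m%:E & ((h / 2) ^+ N <= m)%R.
  exists (fine (mu (hcell a h))).
    by rewrite fineK// ge0_fin_numE// lebesgue_hcell_lty.
  by rewrite -lee_fin fineK ?lebesgue_hcell_ge// ge0_fin_numE// lebesgue_hcell_lty.
have m0 : (0 < m)%R by exact: lt_le_trans mh.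
pose i k := fine (\int[mu]_(x in hcell a h) fiber s p (u k) x).
have I0 k : 0 <= \int[mu]_(x in hcell a h) fiber s p (u k) x.
  by apply: integral_ge0 => x _; exact: gagliardo_fiber_ge0.
have iE k : \int[mu]_(x in hcell a h) fiber s p (u k) x = (i k)%:E.
  by rewrite fineK// ge0_fin_numE// (le_lt_trans (uG k))// ltry.
have i0 k : (0 <= i k)%R by rewrite -lee_fin -iE.
have iG k : (i k <= G)%R by rewrite -lee_fin -iE.
(* Slack providing the strict inequality of [exists_cell_center], even at zero energy; its final
   contribution [2^p * D * e1] is [e/2]. *)
pose e1 := (e / (2 * 2 `^ p * D))%R.
have e10 : (0 < e1)%R by rewrite divr_gt0// !mulr_gt0.
have cP k : exists c : R, \int[mu]_(y in hcell a h) (`|u k y - c| `^ p)%:E <=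
    (D * (i k / m + e1))%:E.
  apply: exists_cell_center => //.
    by rewrite addr_ge0 ?(ltW e10)// divr_ge0 ?(ltW m0).
  rewrite iE mE -EFinM lte_fin mulrDl divfK ?gt_eqF//.
  by rewrite ltrDl mulr_gt0.
have [c {}cP] := choice cP.
have icst (t : R) : \int[mu]_(y in hcell a h) (`|t| `^ p)%:E = (`|t| `^ p * m)%:E.
  by rewrite integral_cst// EFinM; congr (_ * _); exact: mE.
(* [|c k|^p * m] is the integral of a constant over the cell, hence at most [2^p] times the sum of
   the integrals of [|c k - u k|^p] and [|u k|^p]. *)
have cB k : (`|c k| <= (2 `^ p * (D * (G / m + e1) + B) / m) `^ p^-1)%R.
  have -> : (`|c k| = (`|c k| `^ p) `^ p^-1)%R.
    by rewrite -powRrM divff ?gt_eqF// powRr1.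
  apply: ge0_ler_powR; rewrite ?nnegrE ?powR_ge0 ?invr_ge0 ?(ltW p0)//.
    rewrite divr_ge0 ?(ltW m0)// mulr_ge0 ?(ltW pp)// addr_ge0//.
      rewrite mulr_ge0 ?(ltW D0)// addr_ge0 ?(ltW e10)// divr_ge0 ?(ltW m0)//.
      exact: le_trans (iG 0%N).
    rewrite -lee_fin (le_trans _ (uB 0%N))//; apply: integral_ge0 => x _.
    by rewrite lee_fin powR_ge0.
  rewrite ler_pdivlMr// -lee_fin -icst.
  apply: le_trans (integral_powR_split_le _ _ _ (fun y => c k - u k y)%R (u k)
    (ltW p0) mQ _ _ _) _ => //.
  - exact: measurable_funB.
  - by move=> y; rewrite subrK.
  rewrite EFinM; apply: lee_wpmul2l; first by rewrite lee_fin ltW.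
  rewrite EFinD; apply: leeD; last exact: uB.
  under eq_integral do rewrite distrC.
  apply: le_trans (cP k) _; rewrite lee_fin ler_pM2l// lerD2r.
  by rewrite ler_pM2r ?invr_gt0.
have [l cl] := ultra_bounded_cvg _ _ _ _ UU cB.
exists l.
(* Replacing [c k] by [l] contributes [2^p * e2 * m], the other [e/2]. *)
pose e2 := (e / (2 * 2 `^ p * m))%R.
have e20 : (0 < e2)%R by rewrite divr_gt0// !mulr_gt0.
have d0 : (0 < e2 `^ p^-1)%R by rewrite powR_gt0.
have /cvgrPdist_lt/(_ _ d0) := cl.
apply: filterS => k lck.
have {}lck : (`|c k - l| `^ p <= e2)%R.
  have -> : e2 = ((e2 `^ p^-1) `^ p)%R.
    by rewrite -powRrM mulVf ?gt_eqF// powRr1// ltW.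
  by rewrite ge0_ler_powR ?nnegrE ?powR_ge0 ?(ltW p0)// distrC ltW.
apply: le_trans (integral_powR_split_le _ _ _ (fun y => u k y - c k)%R
    (fun=> c k - l)%R (ltW p0) mQ _ _ _) _ => //.
- exact: measurable_funB.
- by move=> y; rewrite addrA subrK.
rewrite icst iE; apply: (@le_trans _ _ ((2 `^ p)%:E * (D * (i k / m + e1) + e2 * m)%:E)).
  apply: lee_wpmul2l; first by rewrite lee_fin ltW.
  by rewrite EFinD; apply: leeD => //; rewrite lee_fin ler_pM2r.
rewrite -!EFinM -EFinD lee_fin.
have -> : (2 `^ p * (D * (i k / m + e1) + e2 * m) = 2 `^ p * D * i k * m^-1 + e)%R.
  by rewrite /e1 /e2; field; rewrite !gt_eqF.
rewrite lerD2r [leRHS](_ : _ = 2 `^ p * D * i k * ((h / 2) ^+ N)^-1)%R; last first.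
  by field; rewrite gt_eqF.
by rewrite ler_wpM2l ?mulr_ge0 ?(ltW pp) ?(ltW D0)// lef_pV2 ?posrE.
Qed.

(** The volume cancels [h^N], and the remaining [h^(s p)] tends to 0 with the mesh. *)
Lemma poincare_cstE s p (h : R) : (0 < h)%R ->
  poincare_cst s p h =
  (2 `^ p * Num.sqrt N%:R `^ (N%:R + s * p) * 2 ^+ N * h `^ (s * p))%R.
Proof.
move=> h0; rewrite powRM ?sqrtr_ge0 ?(ltW h0)//.
rewrite [(h `^ _)%R]powRD ?(gt_eqF h0) ?implybT// powR_mulrn ?(ltW h0)// exprMn exprVn.
by field; rewrite !expf_neq0// gt_eqF.
Qed.

(** On a fine grid, all [u k] with [k] in one member of [U] are close to the same function, constant
    on each cell, hence to each other. *)
Lemma ultra_cauchy_hbox (U : set_system nat) s p (u : nat -> 'rV[R]_N -> R)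
    (r B G e : R) : UltraFilter U ->
  (0 < N%:R :> R)%R -> (0 < p)%R -> (0 < s)%R -> (0 < r)%R -> (0 < e)%R ->
  (forall k, measurable_fun setT (u k)) ->
  (forall k, \int[mu]_(x in hbox r) (`|u k x| `^ p)%:E <= B%:E) ->
  (forall k, \int[mu \x mu]_z (gagliardo_integrand s p (u k) z)%:E <= G%:E) ->
  exists2 A : set nat, U A & forall k l, A k -> A l ->
    \int[mu]_(x in hbox r) (`|u k x - u l x| `^ p)%:E <= e%:E.
Proof.
move=> UU N0 p0 s0 r0 e0 mu_ uB uG.
have sp0 : (0 < s * p)%R by rewrite mulr_gt0.
have pp : (0 < 2 `^ p :> R)%R by rewrite powR_gt0.
have G0 : (0 <= G)%R.
  rewrite -lee_fin (le_trans _ (uG 0%N))//; apply: integral_ge0 => z _.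
  by rewrite lee_fin gagliardo_integrand_ge0.
pose C1 := (2 `^ p * Num.sqrt N%:R `^ (N%:R + s * p) * 2 ^+ N : R)%R.
have C10 : (0 < C1)%R by rewrite !mulr_gt0 ?powR_gt0 ?sqrtr_gt0 ?exprn_gt0.
(* For each function, the integral of the [p]-th power of its distance to the step function will be
   at most [2 * e1]; two of them and the factor [2^p] give [e]. *)
pose e1 := (e / (4 * 2 `^ p))%R.
have e10 : (0 < e1)%R by rewrite divr_gt0// mulr_gt0.
have G1 : (0 < G + 1)%R by rewrite ltr_wpDl.
(* The mesh will satisfy [h^(s p) <= e2], so the energy term is at most [C1 * e2 * (G + 1) = e1]. *)
pose e2 := (e1 / (C1 * (G + 1)))%R.
have e20 : (0 < e2)%R by rewrite divr_gt0// mulr_gt0.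
pose h0 := (e2 `^ (s * p)^-1)%R.
have h00 : (0 < h0)%R by rewrite powR_gt0.
pose M := (Num.truncn (2 * r / h0)%R).+1.
have M0 : (0 < M%:R :> R)%R by rewrite ltr0n.
pose h := (2 * r / M%:R)%R.
have hpos : (0 < h)%R by rewrite divr_gt0// mulr_gt0.
have hh0 : (h <= h0)%R.
  rewrite ler_pdivrMr// [leRHS]mulrC -ler_pdivrMr// ltW// /M.
  have rh0 : (0 <= 2 * r / h0)%R by rewrite divr_ge0 ?mulr_ge0 ?(ltW r0) ?(ltW h00).
  by have /andP[] := truncn_itv rh0.
have kG : (poincare_cst s p h * G <= e1)%R.
  rewrite poincare_cstE// -/C1.
  apply: (@le_trans _ _ (C1 * e2 * (G + 1))%R).
    rewrite ler_pM ?mulr_ge0 ?powR_ge0 ?(ltW C10)//; last by rewrite lerDl.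
    rewrite ler_pM2l// (_ : e2 = h0 `^ (s * p))%R.
      by rewrite ge0_ler_powR ?nnegrE ?(ltW sp0) ?(ltW hpos) ?(ltW h00).
    by rewrite -powRrM mulVf ?gt_eqF// powRr1// ltW.
  by rewrite le_eqVlt; apply/orP; left; apply/eqP; rewrite /e2; field; rewrite !gt_eqF.
have k0 : (0 <= poincare_cst s p h)%R.
  by rewrite poincare_cstE// -/C1 mulr_ge0 ?powR_ge0// ltW.
move: (poincare_cst s p h) kG k0 (@ultra_cell_limit U s p u^~ h) => kk kG k0 hcl.
pose I : finType := {ffun 'I_N -> 'I_M}.
pose cell : I -> set 'rV[R]_N := grid_cell (const_mx (- r)%R) h M.
have boxE (F : 'rV[R]_N -> \bar R) : measurable_fun setT F -> (forall x, 0 <= F x) ->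
    \int[mu]_(x in hbox r) F x = \sum_(f : I) \int[mu]_(x in cell f) F x.
  move=> mF F0; rewrite -ge0_integral_grid// /hbox.
  by rewrite (_ : 2 * r = M%:R * h)%R// /h [RHS]mulrC divfK// gt_eqF.
have mcell f : measurable (cell f) by exact: measurable_hcell.
have mp (v : 'rV[R]_N -> R) : measurable_fun setT v ->
    measurable_fun setT (fun x => (`|v x| `^ p)%:E).
  by move=> mv; apply/measurable_EFinP; exact: measurable_powR_norm.
have cellbox f : cell f `<=` hbox r.
  rewrite /hbox (_ : 2 * r = M%:R * h)%R; last by rewrite /h [RHS]mulrC divfK// gt_eqF.
  rewrite hcell_grid// -bigcup_seq => x xf; exists f => //.
  exact: mem_index_enum.
pose n : R := #|I|%:R.
(* One error [e3] per cell: the [n] errors sum to at most [e1]. *)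
pose e3 := (e1 / (n + 1))%R.
have n0 : (0 <= n)%R by rewrite ler0n.
have e30 : (0 < e3)%R by rewrite divr_gt0// ltr_wpDl.
have cl f : exists l : R, \forall k \near U,
    \int[mu]_(x in cell f) (`|u k x - l| `^ p)%:E <=
    kk%:E * \int[mu]_(x in cell f) fiber s p (u k) x + e3%:E.
  apply: (hcl _ B G) => // k.
    apply: le_trans (uB k); apply: ge0_subset_integral => //.
    - exact: measurable_hcell.
    - exact: measurable_hcell.
    - by apply: measurable_funTS; exact: mp.
    - exact: cellbox.
  apply: le_trans (uG k); rewrite -integral_gagliardo_fiber//.
  apply: ge0_subset_integral => //.
  - exact: measurable_hcell.
  - exact: measurable_gagliardo_fiber.
  - by move=> x _; exact: gagliardo_fiber_ge0.
have [l {}cl] := choice cl.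
(* There are finitely many cells, so one member of [U] serves them all. *)
have /filter_forall Al := cl.
exists [set k | forall f, \int[mu]_(x in cell f) (`|u k x - l f| `^ p)%:E <=
    kk%:E * \int[mu]_(x in cell f) fiber s p (u k) x + e3%:E] => //.
have Sk k : (forall f, \int[mu]_(x in cell f) (`|u k x - l f| `^ p)%:E <=
    kk%:E * \int[mu]_(x in cell f) fiber s p (u k) x + e3%:E) ->
    \sum_(f : I) \int[mu]_(x in cell f) (`|u k x - l f| `^ p)%:E <= (e1 + e1)%:E.
  move=> Ak; apply: le_trans (lee_sum _ (fun f _ => Ak f)) _.
  rewrite big_split/= -ge0_sume_distrr; last first.
    by move=> f _; apply: integral_ge0 => x _; exact: gagliardo_fiber_ge0.
  rewrite -boxE; [|exact: measurable_gagliardo_fiber|by move=> x; exact: gagliardo_fiber_ge0].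
  rewrite EFinD; apply: leeD.
    apply: (@le_trans _ _ (kk%:E * G%:E)); last by rewrite -EFinM lee_fin.
    apply: lee_wpmul2l; first by rewrite lee_fin.
    apply: le_trans (uG k); rewrite -integral_gagliardo_fiber//.
    apply: ge0_subset_integral => //.
    - exact: measurable_hcell.
    - exact: measurable_gagliardo_fiber.
    - by move=> x _; exact: gagliardo_fiber_ge0.
  rewrite sumEFin lee_fin sumr_const -[(_ *+ _)%R]mulr_natr -/n /e3.
  by rewrite mulrAC ler_pdivrMr ?ler_pM2l ?lerDl// ltr_wpDl.
move=> k k' /= Ak Ak'; rewrite boxE; last 2 first.
- by apply: mp; exact: measurable_funB.
- by move=> x; rewrite lee_fin powR_ge0.
apply: (@le_trans _ _ (\sum_(f : I) (2 `^ p)%:E *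
    (\int[mu]_(x in cell f) (`|u k x - l f| `^ p)%:E +
     \int[mu]_(x in cell f) (`|u k' x - l f| `^ p)%:E))).
  apply: lee_sum => f _.
  under [X in _ <= _ * (_ + X)]eq_integral do rewrite distrC.
  apply: integral_powR_split_le (ltW p0) (mcell f) _ _ _ => [||x].
  - exact: measurable_funB.
  - exact: measurable_funB.
  - by rewrite addrA subrK.
rewrite -ge0_sume_distrr; last first.
  by move=> f _; apply: adde_ge0; apply: integral_ge0 => x _; rewrite lee_fin powR_ge0.
rewrite big_split/=.
apply: (@le_trans _ _ ((2 `^ p)%:E * ((e1 + e1)%:E + (e1 + e1)%:E))).
  apply: lee_wpmul2l; first by rewrite lee_fin ltW.
  by apply: leeD; [exact: (Sk k Ak)|exact: (Sk k' Ak')].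
rewrite -EFinD -EFinM lee_fin le_eqVlt; apply/orP; left; apply/eqP.
by rewrite /e1; field; rewrite gt_eqF.
Qed.

End local_compactness.

(** * Subsequences and almost everywhere limits *)

Section sequences_of_functions.

(** Diagonal extraction: [phi m] is chosen beyond the previous index in the intersection of [A 0],
    ..., [A m], which belongs to [U] and so meets every tail. *)
Lemma ultra_subsequence (U : set_system nat) (A : nat -> set nat) :
  UltraFilter U -> \oo `<=` U -> (forall n, U (A n)) ->
  exists2 phi : nat -> nat, increasing_seq phi &
    forall n m, (n <= m)%N -> A n (phi m).
Proof.
move=> UU ooU UA.
have UB n : U [set k | forall i : 'I_n.+1, A i k].
  by apply: filter_forall => i; exact: UA.
have step (nk : nat * nat) : exists j, (nk.2 < j)%N /\
    forall i : 'I_nk.1.+1, A i j.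
  have /filter_ex[j [kj Bj]] : U ([set j | nk.2 < j]%N `&`
      [set k | forall i : 'I_nk.1.+1, A i k]).
    by apply: filterI; [exact: ooU (nbhs_infty_gt _)|exact: UB].
  by exists j.
have [f fP] := choice step.
pose phi := fix phi n := if n is m.+1 then f (n, phi m) else f (0%N, 0%N).
exists phi; first by apply/increasing_seqP => n; have [] := fP (n.+1, phi n).
move=> n m nm; have nm1 : (n < m.+1)%N by rewrite ltnS.
by case: m nm nm1 => [|m] nm nm1; [have [_ /(_ (Ordinal nm1))] := fP (0%N, 0%N)
  |have [_ /(_ (Ordinal nm1))] := fP (m.+1, phi m)].
Qed.

Context d (T : measurableType d) (R : realType).
Variable mu : {measure set T -> \bar R}.
Local Open Scope ereal_scope.

Lemma limn_einf_le (v : (\bar R)^nat) (B : \bar R) :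
  (forall n, v n <= B) -> limn_einf v <= B.
Proof.
move=> vB; rewrite limn_einf_lim; apply: lime_le; first exact: is_cvg_einfs.
apply: nearW => n; apply: le_trans (vB n); apply: ereal_inf_lbound.
by exists n => /=.
Qed.

(** Off a null set [f] is the lower limit of the [F n], so Fatou's lemma passes a uniform bound to
    it. *)
Lemma ae_fatou_le (D : set T) (F : (T -> \bar R)^nat) (f : T -> \bar R) B :
  measurable D -> (forall n, measurable_fun D (F n)) ->
  (forall n x, D x -> 0 <= F n x) -> measurable_fun D f ->
  (forall x, D x -> 0 <= f x) ->
  {ae mu, forall x, D x -> F ^~ x @ \oo --> f x} ->
  (forall n, \int[mu]_(x in D) F n x <= B) -> \int[mu]_(x in D) f x <= B.
Proof.
move=> mD mF F0 mf f0 [Z [mZ Z0 cZ]] FB.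
rewrite (ge0_negligible_integral mZ)//.
have mDZ : measurable (D `\` Z) by exact: measurableD.
have DZD : D `\` Z `<=` D by exact: subDsetl.
rewrite (_ : \int[mu]_(x in _) f x =
    \int[mu]_(x in D `\` Z) limn_einf (F ^~ x)); last first.
  apply: eq_integral => x /set_mem[Dx Zx]; apply/esym.
  suff /cvg_limn_einf_sup[] : F ^~ x @ \oo --> f x by [].
  by apply: contrapT => h; apply: Zx; apply: cZ => /= /(_ Dx).
apply: (le_trans (fatou _ _ _ _)) => //.
- by move=> n; apply: measurable_funS (mF n).
- by move=> n x [Dx _]; exact: F0.
apply: limn_einf_le => n; apply: le_trans (FB n).
by apply: ge0_subset_integral => // x Dx; exact: F0.
Qed.

(** From [n0] on, the increments are dominated by a geometric series, so they sum absolutely and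
    telescope. *)
Lemma cvgn_geometric_step (x : R^nat) (C : R) n0 :
  (forall n, (n0 <= n)%N -> `|x n.+1 - x n| <= C * 2^-1 ^+ n)%R -> cvgn x.
Proof.
move=> xC; pose K := (C * 2^-1 ^+ n0)%R.
have K0 : (0 <= K)%R by exact: le_trans (normr_ge0 _) (xC n0 (leqnn _)).
pose a n := (x (n + n0).+1 - x (n + n0)%N)%R.
have cs : cvgn (series a).
  apply: normed_cvg.
  have : cvgn (series (geometric K 2^-1)).
    apply: is_cvg_geometric_series.
    by rewrite gtr0_norm ?invr_gt0// invf_lt1// ltr1n.
  move=> cg; apply: (series_le_cvg _ _ _ cg) => n; first by rewrite normr_ge0.
    by rewrite /= mulr_ge0// exprn_ge0.
  apply: le_trans (xC _ (leq_addl _ _)) _.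
  by rewrite exprD /K /= mulrAC mulrA.
apply/cvg_ex; exists (limn (series a) + x n0)%R; rewrite -(cvg_shiftn n0).
rewrite (_ : [sequence _]_n = (fun n => series a n + x n0)%R).
  by apply: cvgD => //; exact: cvg_cst.
apply/funext => n; rewrite /series /=.
by rewrite (telescope_sumr (fun k => x (k + n0)%N))// add0n subrK.
Qed.

(* The bound makes the sum over n of (2^n |w_(n+1) - w_n|)^p integrable. *)
Lemma ae_cvg_of_fast_cauchy (p : R) (D : (set T)^nat) (w : (T -> R)^nat) :
  (0 < p)%R -> (forall n, measurable (D n)) ->
  (forall x, \forall n \near \oo, D n x) ->
  (forall n, measurable_fun setT (w n)) ->
  (forall n, \int[mu]_(x in D n) (`|w n.+1 x - w n x| `^ p)%:E <=
    ((2^-1 ^+ n) `^ p / (2 ^ n.+1)%:R)%:E) ->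
  exists2 v : T -> R, measurable_fun setT v &
    {ae mu, forall x, w ^~ x @ \oo --> v x}.
Proof.
move=> p0 mD coverD mw hw.
have mdw n : measurable_fun setT (fun x => ((2 ^+ n) `^ p * `|w n.+1 x - w n x| `^ p)%:E).
  apply/measurable_EFinP; apply: measurable_funM => //.
  by apply: measurable_powR_norm; exact: measurable_funB.
(* The cut-off to [D n] makes the local bounds summable; at each [x] it kills finitely many
   terms. *)
pose F n := (fun x => ((2 ^+ n) `^ p * `|w n.+1 x - w n x| `^ p)%:E) \_ (D n).
have F0 n x : 0 <= F n x.
  by rewrite /F patchE; case: ifPn.
have mF n : measurable_fun setT (F n).
  by apply/(measurable_restrictT _ (mD n)); exact: measurable_funTS.
pose S x := \sum_(n <oo) F n x.
have mS : measurable_fun setT S.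
  by apply: ge0_emeasurable_sum => // k x _ _; exact: F0.
have S0 x : 0 <= S x by apply: nneseries_ge0 => n _ _; exact: F0.
have intS : \int[mu]_x S x <= 1.
  rewrite integral_nneseries//.
  (* The powers of [2^n] and [2^-n] cancel, leaving the series of [1 / 2^(n+1)]. *)
  apply: le_trans (epsilon_trick0 _ ler01); apply: lee_nneseries.
    by move=> n _ _; apply: integral_ge0.
  move=> n _; rewrite /F -integral_mkcond.
  under eq_integral do rewrite EFinM.
  rewrite ge0_integralZl//; last first.
    apply/measurable_EFinP; apply: measurable_funTS; apply: measurable_powR_norm.
    exact: measurable_funB.
  apply: (le_trans (lee_wpmul2l _ (hw n))); first by rewrite lee_fin powR_ge0.
  rewrite -EFinM lee_fin mulrA -powRM ?exprn_ge0// -exprMn.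
  by rewrite divff// expr1n powR1.
have iS : mu.-integrable setT S.
  apply/integrableP; split=> //.
  under eq_integral do rewrite gee0_abs//.
  exact: le_lt_trans intS (ltry _).
pose E := [set x | S x < +oo].
have mE : measurable E.
  rewrite -[E]setTI; exact: emeasurable_fun_infty_o.
have wE x : E x -> cvgn (w ^~ x).
  move=> Ex; have /fineK SE : S x \is a fin_num by rewrite ge0_fin_numE.
  have [n0 _ Dn] := coverD x.
  apply: (@cvgn_geometric_step _ (fine (S x) `^ p^-1)%R n0) => n nn0.
  (* A single term bounded by the sum gives [2^n |w_(n+1) - w_n| <= S^(1/p)], a geometric rate. *)
  have : F n x <= S x.
    apply: le_trans (nneseries_lim_ge n.+1 _); last by move=> k _ _; exact: F0.
    by rewrite big_nat_recr//= leeDr// sume_ge0.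
  rewrite /F patchE mem_set; last exact: Dn.
  rewrite -SE lee_fin -powRM ?exprn_ge0// => h.
  rewrite exprVn ler_pdivlMr ?exprn_gt0// mulrC.
  have := @ge0_ler_powR _ p^-1%R _ _ _ _ _ h.
  rewrite -powRrM mulfV ?gt_eqF// powRr1 ?mulr_ge0 ?exprn_ge0//.
  by apply; rewrite ?nnegrE ?powR_ge0 ?fine_ge0// invr_ge0 ltW.
(* Multiplying by the indicator of [E] makes the sequence converge at every point, so that the limit
   is measurable. *)
pose v x := limn (fun n => w n x * \1_E x)%R.
have wv x : cvgn (fun n => w n x * \1_E x)%R.
  rewrite indicE; have [/set_mem Ex|_] := boolP (x \in E).
    rewrite (_ : (fun n => _) = w ^~ x); first exact: wE.
    by apply/funext => n; rewrite mulr1.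
  rewrite (_ : (fun n => _) = cst 0%R); first exact: is_cvg_cst.
  by apply/funext => n; rewrite mulr0.
exists v.
  apply: (measurable_fun_cvg (h := fun n x => w n x * \1_E x)%R) => [n|x _].
    by apply: measurable_funM => //; exact: measurable_indic.
  exact: wv.
have := integrable_ae measurableT iS.
apply: filterS => x /(_ I) Sx.
have Ex : E x by rewrite /E/= ltey_eq Sx.
rewrite (_ : w ^~ x = (fun n => w n x * \1_E x)%R); first exact: wv.
by apply/funext => n; rewrite indicE mem_set// mulr1.
Qed.

End sequences_of_functions.

(** * Weighted integral estimates and the norm of [X] *)

Section weighted_embedding.
Context {R : realType} {N : nat}.
Local Notation mu := (@lebesgue_rV R N).
Implicit Types (u V W : 'rV[R]_N -> R) (p s : R).
Local Open Scope ereal_scope.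

(** The pointwise inequality is taken at [w = |u x|] and integrated. The cases [r = p] and [r = q]
    serve [K] and [L], with [D] the box carrying the remainder. *)
Lemma integral_weight_le W V (D : set 'rV[R]_N) (p P r e C : R) u :
  (forall x, 0 <= W x)%R -> (forall x, 0 <= V x)%R -> measurable D ->
  measurable_fun setT W -> measurable_fun setT V -> measurable_fun setT u ->
  (0 <= e)%R -> (0 <= C)%R ->
  (forall x (w : R), 0 <= w ->
    W x * w `^ r <= e * (V x * w `^ p + w `^ P) + C * (\1_D x * w `^ p))%R ->
  \int[mu]_x (W x * `|u x| `^ r)%:E <=
  e%:E * (\int[mu]_x (V x * `|u x| `^ p)%:E + \int[mu]_x (`|u x| `^ P)%:E) +
  C%:E * \int[mu]_(x in D) (`|u x| `^ p)%:E.
Proof.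
move=> W0 V0 mD mW mV mu_ e0 C0 h.
have mp (t : R) : measurable_fun setT (fun x => `|u x| `^ t)%R.
  exact: measurable_powR_norm.
have mVp : measurable_fun setT (fun x => (V x * `|u x| `^ p)%:E).
  by apply/measurable_EFinP; exact: measurable_funM.
have mP : measurable_fun setT (fun x => (`|u x| `^ P)%:E).
  exact/measurable_EFinP.
have mDp : measurable_fun setT (fun x => (\1_D x * `|u x| `^ p)%:E).
  apply/measurable_EFinP; apply: measurable_funM; last exact: mp.
  exact: measurable_indic.
have Vp0 x : 0 <= (V x * `|u x| `^ p)%:E by rewrite lee_fin mulr_ge0 ?powR_ge0.
have Dp0 x : 0 <= (\1_D x * `|u x| `^ p)%:E.
  by rewrite lee_fin mulr_ge0 ?powR_ge0.
have -> : \int[mu]_(x in D) (`|u x| `^ p)%:E =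
    \int[mu]_x (\1_D x * `|u x| `^ p)%:E.
  rewrite integral_mkcond; apply: eq_integral => x _.
  by rewrite patchE indicE; case: ifPn; rewrite ?mul1r ?mul0r.
rewrite -ge0_integralD// -!ge0_integralZl//; last 2 first.
- exact: emeasurable_funD.
- by move=> x _; rewrite adde_ge0// lee_fin powR_ge0.
rewrite -ge0_integralD//; last 4 first.
- by move=> x _; rewrite mule_ge0// adde_ge0// lee_fin powR_ge0.
- by apply: measurable_funeM; exact: emeasurable_funD.
- by move=> x _; rewrite mule_ge0.
- exact: measurable_funeM.
apply: ge0_le_integral => //.
- by move=> x _; rewrite lee_fin mulr_ge0 ?powR_ge0.
- by apply/measurable_EFinP; exact: measurable_funM.
- apply: emeasurable_funD; apply: measurable_funeM => //.
  exact: emeasurable_funD.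
- by move=> x _; rewrite -!EFinM -!EFinD lee_fin h.
Qed.

Lemma integral_weight_scale W (r t : R) u : (forall x, 0 <= W x)%R ->
  measurable_fun setT W -> measurable_fun setT u -> (0 <= t)%R ->
  \int[mu]_x (W x * `|t * u x| `^ r)%:E =
  (t `^ r)%:E * \int[mu]_x (W x * `|u x| `^ r)%:E.
Proof.
move=> W0 mW mu_ t0; rewrite -ge0_integralZl//; last 3 first.
- apply/measurable_EFinP; apply: measurable_funM => //.
  exact: measurable_powR_norm.
- by move=> x _; rewrite lee_fin mulr_ge0 ?powR_ge0.
- by rewrite lee_fin powR_ge0.
apply: eq_integral => x _; rewrite -EFinM; congr (_%:E).
by rewrite normrM (ger0_norm t0) powRM// mulrCA.
Qed.

Lemma wnorm_le W (r a : R) u : (0 < r)%R -> (forall x, 0 <= W x)%R -> (0 <= a)%R ->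
  \int[mu]_x (W x * `|u x| `^ r)%:E <= (a `^ r)%:E -> wnorm W r u <= a%:E.
Proof.
move=> r0 W0 a0 h; rewrite /wnorm.
have -> : a%:E = (a `^ r)%:E `^ r^-1.
  by rewrite poweR_EFin -powRrM mulfV ?gt_eqF// powRr1.
apply: gt0_ler_poweR => //; first by rewrite invr_ge0 ltW.
- rewrite in_itv/= leey andbT; apply: integral_ge0 => x _.
  by rewrite lee_fin mulr_ge0 ?powR_ge0.
- by rewrite in_itv/= leey andbT lee_fin powR_ge0.
Qed.

(** Gives the unweighted [L^p] bound on a box that local compactness starts from. *)
Lemma integral_le_weight V (D : set 'rV[R]_N) p (c : R) u :
  measurable D -> measurable_fun setT V -> measurable_fun setT u ->
  (0 < c)%R -> (forall x, 0 <= V x)%R -> (forall x, D x -> c <= V x)%R ->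
  \int[mu]_(x in D) (`|u x| `^ p)%:E <=
  c^-1%:E * \int[mu]_x (V x * `|u x| `^ p)%:E.
Proof.
move=> mD mV mu_ c0 V0 cV.
have mp : measurable_fun setT (fun x => `|u x| `^ p)%R by exact: measurable_powR_norm.
have mVp : measurable_fun setT (fun x => (V x * `|u x| `^ p)%:E).
  by apply/measurable_EFinP; exact: measurable_funM.
have Vp0 x : 0 <= (V x * `|u x| `^ p)%:E by rewrite lee_fin mulr_ge0 ?powR_ge0.
rewrite lee_pdivlMl// -ge0_integralZl//; last 2 first.
- by apply/measurable_EFinP; apply: measurable_funTS.
- by rewrite lee_fin ltW.
apply: (@le_trans _ _ (\int[mu]_(x in D) (V x * `|u x| `^ p)%:E)); last first.
  exact: ge0_subset_integral.
apply: ge0_le_integral => //.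
- by move=> x _; rewrite mule_ge0// lee_fin ?powR_ge0// ltW.
- by apply: measurable_funTS; apply: measurable_funeM; exact/measurable_EFinP.
- exact: measurable_funTS.
- by move=> x Dx; rewrite -EFinM lee_fin ler_wpM2r ?powR_ge0// cV.
Qed.

(** Raising the norm to the power [p] undoes the roots, and each nonnegative term is at most the
    sum. Finiteness of the Sobolev integral is kept because [fractional_sobolev] asks for it. *)
Lemma Xspace_bounds V s p u (t : R) : (0 < p)%R -> (0 < sobolev_exponent N s p)%R ->
  (forall x, 0 <= V x)%R -> Xspace V s p u -> (0 <= t)%R ->
  Xnorm V s p u <= t%:E ->
  [/\ measurable_fun setT u,
      \int[mu]_x (`|u x| `^ sobolev_exponent N s p)%:E < +oo,
      \int[mu \x mu]_z (gagliardo_integrand s p u z)%:E <= (t `^ p)%:E &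
      \int[mu]_x (V x * `|u x| `^ p)%:E <= (t `^ p)%:E].
Proof.
move=> p0 P0 V0 [uL _ _] t0 ut.
have G0 : 0 <= \int[mu \x mu]_z (gagliardo_integrand s p u z)%:E.
  by apply: integral_ge0 => z _; rewrite lee_fin gagliardo_integrand_ge0.
have W0 : 0 <= \int[mu]_x (V x * `|u x| `^ p)%:E.
  by apply: integral_ge0 => x _; rewrite lee_fin mulr_ge0 ?powR_ge0.
have invp (z : \bar R) : 0 <= z -> (z `^ p^-1) `^ p = z.
  by move=> z0; rewrite -poweRrM mulVf ?gt_eqF// poweRe1.
have GW : \int[mu \x mu]_z (gagliardo_integrand s p u z)%:E +
    \int[mu]_x (V x * `|u x| `^ p)%:E <= (t `^ p)%:E.
  have -> : (t `^ p)%:E = t%:E `^ p by rewrite poweR_EFin.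
  rewrite -[leLHS](invp _ (adde_ge0 G0 W0)).
  apply: gt0_ler_poweR; first exact: ltW.
  - by rewrite in_itv/= leey andbT poweR_ge0.
  - by rewrite in_itv/= leey andbT lee_fin.
  - by move: ut; rewrite /Xnorm /gagliardo /wnorm (invp _ G0) (invp _ W0).
split.
- by have /sub_Lfun_mfun := uL; rewrite inE.
- have /sub_Lfun_finLfun := uL; rewrite inE /= /finite_norm unlock /=.
  by move=> /lty_poweRy; rewrite invr_eq0 gt_eqF// => /(_ isT).
- by apply: le_trans GW; rewrite leeDl.
- by apply: le_trans GW; rewrite leeDr.
Qed.

Lemma Xnorm_fin_num V s p u : Xspace V s p u -> Xnorm V s p u \is a fin_num.
Proof.
move=> [_ ug uw]; rewrite ge0_fin_numE ?poweR_ge0//.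
by apply: poweR_lty; rewrite lte_add_pinfty// poweR_lty.
Qed.

Lemma cvg_powR_norm (x : R^nat) (l p : R) : (0 < p)%R ->
  x @ \oo --> l -> (fun n => `|x n| `^ p)%R @ \oo --> (`|l| `^ p)%R.
Proof.
move=> p0 xl.
have nxl : (fun n => `|x n|)%R @ \oo --> `|l|%R by exact: cvg_norm.
(* At [l = 0] the limit is checked directly; elsewhere the power is differentiable at [|l| > 0]. *)
have [l0|l0] := eqVneq l 0%R.
  rewrite l0 normr0 powR0 ?gt_eqF//; apply/cvgrPdist_le => e e0.
  have ep0 : (0 < e `^ p^-1)%R by rewrite powR_gt0.
  move: xl; rewrite l0 => /cvgrPdist_le/(_ _ ep0).
  apply: filterS => n; rewrite !sub0r !normrN => xe.
  rewrite ger0_norm ?powR_ge0//.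
  rewrite -[leRHS](powRr1 (ltW e0)) -[X in (_ <= _ `^ X)%R](mulVf (lt0r_neq0 p0)) powRrM.
  by rewrite ge0_ler_powR ?nnegrE ?powR_ge0// ltW.
have dl : differentiable (@powR R ^~ p) `|l|%R.
  apply/derivable1_diffP; apply: derivable_powR.
  by rewrite in_itv/= andbT normr_gt0.
exact: continuous_cvg (differentiable_continuous dl) nxl.
Qed.

Lemma cvge0_of_le (f : (\bar R)^nat) : (forall n, 0 <= f n) ->
  (forall e : R, (0 < e)%R -> \forall n \near \oo, f n <= e%:E) ->
  f @ \oo --> 0.
Proof.
move=> f0 fe; apply/fine_cvgP; split.
  apply: filterS (fe 1%R ltr01) => n f1.
  by rewrite ge0_fin_numE// (le_lt_trans f1)// ltry.
apply/cvgrPdist_le => e e0; apply: filterS (fe e e0) => n fne.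
rewrite sub0r normrN ger0_norm ?fine_ge0//.
by rewrite -lee_fin fineK// ge0_fin_numE// (le_lt_trans fne)// ltry.
Qed.

(** Apply [integral_weight_le] to [u / t]: the exponents [p], [P] and [r] differ, and this
    normalization restores the homogeneous factor [t^r]. *)
Lemma weighted_embedding_le W V (p P r C CS t : R) u :
  (0 <= C)%R -> (0 < t)%R -> (forall x, 0 <= W x)%R -> (forall x, 0 <= V x)%R ->
  measurable_fun setT W -> measurable_fun setT V -> measurable_fun setT u ->
  (forall x (w : R), 0 <= w -> W x * w `^ r <= C * (V x * w `^ p + w `^ P))%R ->
  \int[mu]_x (V x * `|u x| `^ p)%:E <= (t `^ p)%:E ->
  \int[mu]_x (`|u x| `^ P)%:E <= (CS * t `^ P)%:E ->
  \int[mu]_x (W x * `|u x| `^ r)%:E <= (C * (1 + CS) * t `^ r)%:E.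
Proof.
move=> C0 t0 W0 V0 mW mV mu_ h uV uP.
have ti0 : (0 <= t^-1)%R by rewrite invr_ge0 ltW.
have tr0 a : (0 < t `^ a)%R by rewrite powR_gt0.
have tiE a : (t^-1 `^ a = (t `^ a)^-1)%R.
  by rewrite -powR_inv1 ?(ltW t0)// -powRrM mulN1r powRN.
have mtu : measurable_fun setT (fun x => t^-1 * u x)%R by exact: measurable_funM.
have := @integral_weight_le W V set0 p P r C 0%R _ W0 V0 measurable0 mW mV mtu C0 (lexx _).
move=> /(_ _)/wrap[|]; first by move=> x w w0; rewrite mul0r addr0 h.
rewrite mul0e adde0 !integral_weight_scale//.
have -> : \int[mu]_x (`|t^-1 * u x| `^ P)%:E = (t^-1 `^ P)%:E * \int[mu]_x (`|u x| `^ P)%:E.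
  have := @integral_weight_scale (cst 1%R) P t^-1 u (fun=> ler01) (measurable_cst _) mu_ ti0.
  by under eq_integral do rewrite mul1r; under [in RHS]eq_integral do rewrite mul1r.
rewrite !tiE => h1; rewrite [leRHS](_ : _ = (t `^ r)%:E * (C * (1 + CS))%:E); last first.
  by rewrite -EFinM mulrC.
rewrite -lee_pdivrMl//; apply: le_trans h1 _.
rewrite EFinM; apply: lee_wpmul2l; first by rewrite lee_fin.
rewrite EFinD; apply: leeD; rewrite lee_pdivrMl//.
  by rewrite mule1.
by rewrite -EFinM mulrC.
Qed.

End weighted_embedding.

(** * Inclusion, continuity and compactness of the embedding of [X] *)

Theorem proposition1p1 (R : realType) (N : nat) (p s q : R)
    (V K L : 'rV[R]_N -> R) :
  1 < p -> 0 < s -> s < 1 -> s * p < N%:R ->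
  p < q -> q < sobolev_exponent N s p ->
  (forall x, 0 < V x) -> (forall x, 0 < K x) -> (forall x, 0 < L x) ->
  continuous V -> continuous K -> continuous L ->
  bounded_fun K -> bounded_fun L ->
  K x / V x @[x --> eucl_infty R N] --> 0 ->
  L x / V x `^ ((N%:R * p - (N%:R - s * p) * q) / (s * p ^+ 2))
    @[x --> eucl_infty R N] --> 0 ->
  compactly_embedded
    (Xspace V s p) (Xnorm V s p)
    (wLspace K p `&` wLspace L q) (fun u => (wnorm K p u + wnorm L q u)%E).
Proof.
move=> p1 s0 s1 spN pq qP V0 K0 L0 cV cK cL bK bL KV.
have p0 : 0 < p by exact: lt_trans p1.
have q0 : 0 < q by exact: lt_trans pq.
have N0 : 0 < N%:R :> R by rewrite (lt_trans _ spN)// mulr_gt0.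
have D0 : 0 < N%:R - s * p by rewrite subr_gt0.
(* With [P] the Sobolev exponent, [P - p = s p^2 / (N - s p)], so the exponent of [V] is the
   interpolation coefficient. *)
rewrite (_ : _ / (s * p ^+ 2) =
    (sobolev_exponent N s p - q) / (sobolev_exponent N s p - p)) => [LV|]; last first.
  rewrite /sobolev_exponent (_ : _ - p = s * p ^+ 2 / (N%:R - s * p)).
    by field; rewrite !gt_eqF.
  by field; rewrite gt_eqF.
have P0 : 0 < sobolev_exponent N s p by exact: lt_trans qP.
have [CS CS0 sob] := fractional_sobolev _ _ p1 s0 spN.
have [C1 C10 glob] := weights_le_global _ _ _ _ _ _ p0 pq qP V0 cV bK bL KV LV.
(* From here the Sobolev exponent is a variable [P], known through the facts carried along. *)
move: (sobolev_exponent N s p) (@Xspace_bounds R N V s p) (@weights_le R N V K L p q)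
  qP KV LV P0 sob glob => P Xb wle qP KV LV P0 sob glob.
have mV := continuous_measurable_rV _ cV.
have mK := continuous_measurable_rV _ cK.
have mL := continuous_measurable_rV _ cL.
have V0' x : 0 <= V x by exact: ltW.
have K0' x : 0 <= K x by exact: ltW.
have L0' x : 0 <= L x by exact: ltW.
(* Everything is phrased with a positive upper bound [t] of the norm, as the norm itself may
   vanish. *)
have bounds u t : 0 < t -> Xspace V s p u -> (Xnorm V s p u <= t%:E)%E ->
    [/\ measurable_fun setT u,
        (\int[lebesgue_rV N \x lebesgue_rV N]_z
          (gagliardo_integrand s p u z)%:E <= (t `^ p)%:E)%E,
        (\int[lebesgue_rV N]_x (V x * `|u x| `^ p)%:E <= (t `^ p)%:E)%E &
        (\int[lebesgue_rV N]_x (`|u x| `^ P)%:E <= (CS * t `^ P)%:E)%E].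
  move=> t0 Xu ut; have [mu uP uG uV] := Xb u t p0 P0 V0' Xu (ltW t0) ut.
  by split => //; apply: sob => //; exact: ltW.
pose C2 := C1 * (1 + CS).
have C20 : 0 <= C2 by rewrite mulr_ge0// addr_ge0// ltW.
have embK u t : 0 < t -> Xspace V s p u -> (Xnorm V s p u <= t%:E)%E ->
    (\int[lebesgue_rV N]_x (K x * `|u x| `^ p)%:E <= (C2 * t `^ p)%:E)%E.
  move=> t0 Xu ut; have [mu uG uV uP] := bounds u t t0 Xu ut.
  apply: (weighted_embedding_le _ _ _ _ _ _ _ _ _ C10 t0 K0' V0' mK mV mu _ uV uP).
  move=> x w w0; apply: le_trans (glob x w w0).
  by rewrite lerDl mulr_ge0 ?powR_ge0.
have embL u t : 0 < t -> Xspace V s p u -> (Xnorm V s p u <= t%:E)%E ->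
    (\int[lebesgue_rV N]_x (L x * `|u x| `^ q)%:E <= (C2 * t `^ q)%:E)%E.
  move=> t0 Xu ut; have [mu uG uV uP] := bounds u t t0 Xu ut.
  apply: (weighted_embedding_le _ _ _ _ _ _ _ _ _ C10 t0 L0' V0' mL mV mu _ uV uP).
  move=> x w w0; apply: le_trans (glob x w w0).
  by rewrite lerDr mulr_ge0 ?powR_ge0.
have Xfin u : Xspace V s p u -> (Xnorm V s p u = (fine (Xnorm V s p u))%:E)%E.
  by move=> Xu; rewrite fineK// Xnorm_fin_num.
have Xfin0 u : 0 <= fine (Xnorm V s p u) by rewrite fine_ge0// poweR_ge0.
split.
- move=> u Xu.
  have t0 : 0 < fine (Xnorm V s p u) + 1 by rewrite ltr_wpDl.
  have ut : (Xnorm V s p u <= (fine (Xnorm V s p u) + 1)%:E)%E.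
    by rewrite {1}(Xfin u Xu) lee_fin lerDl.
  have [mu _ _ _] := bounds _ _ t0 Xu ut.
  split; split => //.
    by rewrite (le_lt_trans (embK _ _ t0 Xu ut))// ltry.
  by rewrite (le_lt_trans (embL _ _ t0 Xu ut))// ltry.
- pose C3 := C2 `^ p^-1 + C2 `^ q^-1.
  have C30 : 0 <= C3 by rewrite addr_ge0 ?powR_ge0.
  have C31 : 0 < C3 + 1 by rewrite ltr_wpDl.
  exists C3 => u Xu; apply/lee_addgt0Pr => e e0.
  (* The increment keeps [t] positive and costs at most [C3 * e / (C3 + 1) <= e]. *)
  pose t := fine (Xnorm V s p u) + e / (C3 + 1).
  have t0 : 0 < t by rewrite ltr_wpDl// divr_gt0.
  have ut : (Xnorm V s p u <= t%:E)%E.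
    by rewrite {1}(Xfin u Xu) lee_fin lerDl divr_ge0// ltW.
  have powC r : 0 < r -> C2 * t `^ r = (C2 `^ r^-1 * t) `^ r.
    move=> r0; rewrite powRM ?powR_ge0 ?(ltW t0)// -powRrM mulVf ?gt_eqF//.
    by rewrite powRr1.
  apply: (@le_trans _ _ ((C2 `^ p^-1 * t)%:E + (C2 `^ q^-1 * t)%:E)%E).
    apply: leeD; apply: wnorm_le; rewrite ?mulr_ge0 ?powR_ge0 ?(ltW t0)// -powC//.
      exact: embK.
    exact: embL.
  rewrite (Xfin u Xu) -EFinD -EFinM -EFinD lee_fin -mulrDl -/C3 mulrDr lerD2l.
  by rewrite mulrCA ler_piMr ?(ltW e0)// ler_pdivrMr// mul1r lerDl.
move=> u Xu [M uM]; pose t := `|M| + 1.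
have t0 : 0 < t by rewrite ltr_wpDl.
have ut k : (Xnorm V s p (u k) <= t%:E)%E.
  by rewrite (le_trans (uM k))// lee_fin (le_trans (ler_norm _))// lerDl.
have mu_ k : measurable_fun setT (u k) by have [] := bounds _ _ t0 (Xu k) (ut k).
(* An ultrafilter containing the tails makes every bounded scalar sequence converge before any
   subsequence is extracted. *)
have [U [UU ooU]] := @ultraFilterLemma nat \oo _.
(* The rate demanded by [ae_cvg_of_fast_cauchy], on the box of radius [n + 1]. *)
pose eps n : R := (2^-1 ^+ n) `^ p / (2 ^ n.+1)%:R.
have eps0 n : 0 < eps n by rewrite divr_gt0 ?powR_gt0 ?exprn_gt0// ltr0n expn_gt0.
have exA n : exists B : set nat, U B /\ forall k l, B k -> B l ->
    (\int[lebesgue_rV N]_(x in hbox n.+1%:R) (`|u k x - u l x| `^ p)%:E <= (eps n)%:E)%E.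
  have [c c0 hc] := hbox_continuous_gt0 _ n.+1%:R cV V0.
  have r0 : 0 < n.+1%:R :> R by rewrite ltr0n.
  have uB k : (\int[lebesgue_rV N]_(x in hbox n.+1%:R) (`|u k x| `^ p)%:E <=
      (c^-1 * t `^ p)%:E)%E.
    have [_ _ uV _] := bounds _ _ t0 (Xu k) (ut k).
    apply: le_trans (integral_le_weight _ _ p _ _ _ mV (mu_ k) c0 V0' hc) _.
      exact: measurable_hcell.
    by rewrite EFinM; apply: lee_wpmul2l => //; rewrite lee_fin invr_ge0 ltW.
  have uG k : (\int[lebesgue_rV N \x lebesgue_rV N]_z
      (gagliardo_integrand s p (u k) z)%:E <= (t `^ p)%:E)%E.
    by have [] := bounds _ _ t0 (Xu k) (ut k).
  have [A0 UA0 hA0] := ultra_cauchy_hbox _ _ _ _ _ _ _ _ UU N0 p0 s0 r0 (eps0 n) mu_ uB uG.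
  by exists A0; split.
have [A AP] := choice exA.
have UA n : U (A n) by have [] := AP n.
have [phi incphi Aphi] := ultra_subsequence _ _ UU ooU UA.
pose w n := u (phi n).
have mw n : measurable_fun setT (w n) by exact: mu_.
have wA n k l : (n <= k)%N -> (n <= l)%N ->
    (\int[lebesgue_rV N]_(x in hbox n.+1%:R) (`|w k x - w l x| `^ p)%:E <= (eps n)%:E)%E.
  by move=> nk nl; have [_] := AP n; apply; exact: Aphi.
have mhbox r : measurable (@hbox R N r) by exact: measurable_hcell.
have coverD x : \forall n \near \oo, @hbox R N n.+1%:R x.
  apply: filterS (nbhs_infty_gtr (eucl_norm x)) => n xn.
  by apply: eucl_norm_lt_hbox; rewrite (lt_trans xn)// ltr_nat.
have [v mv wv] := ae_cvg_of_fast_cauchy _ _ _ (lebesgue_rV N) p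
  (fun n => hbox n.+1%:R) w p0 (fun n => mhbox _) coverD mw
  (fun n => wA n n.+1 n (leqnSn n) (leqnn n)).
have cvgE (a : R^nat) (l : R) : a @ \oo --> l ->
    (fun n => (a n)%:E) @ \oo --> l%:E.
  by move=> al; apply: cvg_EFin => //; exact: nearW.
have mWf (W f : 'rV[R]_N -> R) r : measurable_fun setT W -> measurable_fun setT f ->
    measurable_fun setT (fun x => (W x * `|f x| `^ r)%:E).
  move=> mW mf; apply/measurable_EFinP; apply: measurable_funM => //.
  exact: measurable_powR_norm.
have mpf (f : 'rV[R]_N -> R) r : measurable_fun setT f ->
    measurable_fun setT (fun x => (`|f x| `^ r)%:E).
  by move=> mf; apply/measurable_EFinP; exact: measurable_powR_norm.
have wV n : (\int[lebesgue_rV N]_x (V x * `|w n x| `^ p)%:E <= (t `^ p)%:E)%E.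
  by have [] := bounds _ _ t0 (Xu (phi n)) (ut (phi n)).
have wP n : (\int[lebesgue_rV N]_x (`|w n x| `^ P)%:E <= (CS * t `^ P)%:E)%E.
  by have [] := bounds _ _ t0 (Xu (phi n)) (ut (phi n)).
have vV : (\int[lebesgue_rV N]_x (V x * `|v x| `^ p)%:E <= (t `^ p)%:E)%E.
  apply: (ae_fatou_le _ _ _ _ _ (fun n x => (V x * `|w n x| `^ p)%:E)) => //.
  - by move=> n; exact: mWf.
  - by move=> n x _; rewrite lee_fin mulr_ge0 ?powR_ge0.
  - exact: mWf.
  - by move=> x _; rewrite lee_fin mulr_ge0 ?powR_ge0.
  - apply: filterS wv => x wx _; apply: cvgE.
    by apply: cvgM; [exact: cvg_cst|exact: cvg_powR_norm].
have vP : (\int[lebesgue_rV N]_x (`|v x| `^ P)%:E <= (CS * t `^ P)%:E)%E.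
  apply: (ae_fatou_le _ _ _ _ _ (fun n x => (`|w n x| `^ P)%:E)) => //.
  - by move=> n; exact: mpf.
  - exact: mpf.
  - by apply: filterS wv => x wx _; apply: cvgE; exact: cvg_powR_norm.
have mz m : measurable_fun setT (fun x => w m x - v x) by exact: measurable_funB.
(* Fatou in [l] applied to the Cauchy bound between [w m] and [w (l + m)]. *)
have zA m : (\int[lebesgue_rV N]_(x in hbox m.+1%:R) (`|w m x - v x| `^ p)%:E <=
    (eps m)%:E)%E.
  apply: (ae_fatou_le _ _ _ _ _ (fun l x => (`|w m x - w (l + m)%N x| `^ p)%:E)) => //.
  - by move=> l; apply: measurable_funTS; apply: mpf; exact: measurable_funB.
  - by apply: measurable_funTS; exact: mpf.
  - apply: filterS wv => x wx _; apply: cvgE; apply: cvg_powR_norm => //.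
    apply: cvgB; first exact: cvg_cst.
    by move: wx; rewrite -(cvg_shiftn m).
  - by move=> l; apply: wA => //; exact: leq_addl.
(* Bound, uniform in [m], for the two global integrals of [w m - v] together. *)
pose E := 2 `^ p * (t `^ p + t `^ p) + 2 `^ P * (CS * t `^ P + CS * t `^ P).
have zV m : (\int[lebesgue_rV N]_x (V x * `|w m x - v x| `^ p)%:E <=
    (2 `^ p * (t `^ p + t `^ p))%:E)%E.
  apply: le_trans (integral_weight_powR_split_le _ _ _ _ (w m) (fun x => - v x)
    (ltW p0) measurableT V0' mV (mw m) _ _) _ => //; first exact: measurable_funN.
  rewrite EFinM; apply: lee_wpmul2l; first by rewrite lee_fin powR_ge0.
  under [X in (_ + X <= _)%E]eq_integral do rewrite normrN.
  by rewrite EFinD; apply: leeD; [exact: wV|exact: vV].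
have zP m : (\int[lebesgue_rV N]_x (`|w m x - v x| `^ P)%:E <=
    (2 `^ P * (CS * t `^ P + CS * t `^ P))%:E)%E.
  apply: le_trans (integral_powR_split_le _ _ _ (w m) (fun x => - v x)
    (ltW P0) measurableT (mw m) _ _) _ => //; first exact: measurable_funN.
  rewrite EFinM; apply: lee_wpmul2l; first by rewrite lee_fin powR_ge0.
  under [X in (_ + X <= _)%E]eq_integral do rewrite normrN.
  by rewrite EFinD; apply: leeD; [exact: wP|exact: vP].
have E0 : 0 <= E.
  by rewrite addr_ge0 ?mulr_ge0 ?addr_ge0 ?mulr_ge0 ?powR_ge0 ?(ltW CS0).
have epsle m : eps m <= m.+1%:R^-1.
  rewrite /eps ler_pdivrMr ?ltr0n ?expn_gt0//.
  apply: (@le_trans _ _ 1); last first.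
    by rewrite mulrC ler_pdivlMr ?ltr0n// mul1r ler_nat ltnW// ltn_expl.
  apply: (@le_trans _ _ (1 `^ p)); last by rewrite powR1.
  rewrite ge0_ler_powR ?nnegrE ?(ltW p0) ?exprn_ge0//.
  by rewrite exprn_ile1// invf_le1// ler1n.
have small d : 0 < d -> \forall m \near \oo,
    (\int[lebesgue_rV N]_x (K x * `|w m x - v x| `^ p)%:E <= d%:E)%E /\
    (\int[lebesgue_rV N]_x (L x * `|w m x - v x| `^ q)%:E <= d%:E)%E.
  (* The global part then costs [e * E <= d/2]; the other half of [d] is left for the box. *)
  move=> d0; pose e := d / (2 * (E + 1)).
  have e0 : 0 < e by rewrite divr_gt0// mulr_gt0// ltr_wpDl.
  have [r [C [C0 hC]]] := wle P e p0 pq qP V0 bK bL KV LV e0.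
  have dC0 : 0 < d / (2 * (C + 1)) by rewrite divr_gt0// mulr_gt0// ltr_wpDl.
  (* [m > r] puts the box of radius [r] inside the one where [zA] applies, and [eps m <= 1/(m+1)]
     makes the remainder small. *)
  apply: filterS2 (nbhs_infty_gtr r) (near_infty_natSinv_lt (PosNum dC0)) => m rm md.
  have rest : (e%:E * (\int[lebesgue_rV N]_x (V x * `|w m x - v x| `^ p)%:E +
        \int[lebesgue_rV N]_x (`|w m x - v x| `^ P)%:E) +
      C%:E * \int[lebesgue_rV N]_(x in hbox r) (`|w m x - v x| `^ p)%:E <= d%:E)%E.
    apply: (@le_trans _ _ (e%:E * E%:E + C%:E * (d / (2 * (C + 1)))%:E)%E).
      apply: leeD; apply: lee_wpmul2l; rewrite ?lee_fin ?(ltW e0)//.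
        by rewrite /E EFinD; apply: leeD; [exact: zV|exact: zP].
      apply: (@le_trans _ _ (eps m)%:E).
        apply: le_trans (zA m); apply: ge0_subset_integral => //.
          by apply: measurable_funTS; exact: mpf.
        by apply: le_hbox; rewrite (le_trans (ltW rm))// ler_nat.
      by rewrite lee_fin (le_trans (epsle m))// ltW.
    rewrite -!EFinM -EFinD lee_fin.
    have half (a : R) : 0 <= a -> d / (2 * (a + 1)) * a <= d / 2.
      move=> a0; have a1 : 0 < a + 1 by rewrite ltr_wpDl.
      rewrite (_ : _ * a = d / 2 * (a / (a + 1))); last by field; rewrite gt_eqF.
      rewrite ler_piMr ?divr_ge0 ?(ltW d0)//.
      by rewrite ler_pdivrMr// mul1r lerDl.
    by rewrite [leRHS]splitr lerD ?half// mulrC half.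
  split; apply: le_trans rest; apply: integral_weight_le => //; rewrite ?(ltW e0)//.
  - move=> x a a0; apply: le_trans (hC x a a0).
    by rewrite lerDl mulr_ge0 ?powR_ge0.
  - move=> x a a0; apply: le_trans (hC x a a0).
    by rewrite lerDr mulr_ge0 ?powR_ge0.
(* [v] lies in the target because Fatou gave it the same integral bounds as the sequence. *)
exists phi => //; exists v.
  split; split => //.
    apply: le_lt_trans (weighted_embedding_le _ _ _ _ p _ _ _ _ C10 t0
      K0' V0' mK mV mv _ vV vP) (ltry _).
    move=> x a a0; apply: le_trans (glob x a a0).
    by rewrite lerDl mulr_ge0 ?powR_ge0.
  apply: le_lt_trans (weighted_embedding_le _ _ _ _ q _ _ _ _ C10 t0
    L0' V0' mL mV mv _ vV vP) (ltry _).
  move=> x a a0; apply: le_trans (glob x a a0).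
  by rewrite lerDr mulr_ge0 ?powR_ge0.
apply: cvge0_of_le => [m|e e0]; first by rewrite adde_ge0 ?poweR_ge0.
have e20 : 0 < e / 2 by rewrite divr_gt0.
(* The two norms are a [p]-th and a [q]-th root; the minimum makes each at most [e / 2]. *)
have d0 : 0 < Num.min ((e / 2) `^ p) ((e / 2) `^ q) by rewrite lt_min !powR_gt0.
apply: filterS (small _ d0) => m [zK zL].
have -> : e = e / 2 + e / 2 by field.
rewrite EFinD; apply: leeD; apply: wnorm_le; rewrite ?(ltW e20)//.
  by apply: le_trans zK _; rewrite lee_fin ge_min lexx.
by apply: le_trans zL _; rewrite lee_fin ge_min lexx orbT.
Qed.
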